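(* Let $V$ be a set of $n$ vertices and let $e_1,\ldots,e_{n-1}$ be a sequence of edges on $V$ that form a tree, arriving one at a time. With high probability in $n$, the Dancing-Walk Algorithm (defined in the context) can process all of $e_1,\ldots,e_{n-1}$ without declaring failure. If the algorithm does not declare failure, then each step (edge insertion) flips $O(\log\log n)$ edges and takes $O(\log n\log\log n)$ time. Additionally, no vertex's out-degree ever exceeds $3$.
   Context: Conventions. Logarithms are base 2; quantities such as $c\log\log n$, $(\log n)^c$, $d\log n$ are treated as integers. Running time is in the usual unit-cost RAM model. $c$ and $d$ are sufficiently large constants (parameters of the algorithm). ''With high probability in $n$'' means with probability at least $1-1/n^a$, where the constant $a>0$ can be made as large as desired by choosing the constants $c,d$ sufficiently large. The edge sequence is fixed independently of the algorithm's random bits. Problem (incremental edge orientation in a forest). After each arrival the algorithm must maintain an orientation (choice of direction) of all edges inserted so far; the edges inserted so far always form a forest on $V$. Flipping an edge means reversing its direction. The Dancing-Walk Algorithm. Each vertex has at most two primary out-going edges and at most one secondary out-going edge. When $e_t=\{v_1,v_2\}$ arrives, let $T_1\ni v_1$, $T_2\ni v_2$ be the two (undirected) trees of the current forest joined by $e_t$, with names chosen so that $|T_1|\le |T_2|$ (ties broken arbitrarily; sizes are obtained from a union-find structure with $O(\log n)$ worst-case operation time). The algorithm performs a random walk starting at $v_1$ along primary directed edges. If the walk is at a vertex of out-degree less than $2$ (possibly $v_1$ itself), the walk terminates successfully there. Otherwise it moves along a uniformly random one of the two primary out-going edges of the current vertex. If the walk has not terminated earlier, it stops after $c\log\log n$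 moves at a vertex $u$; if $u$ has out-degree less than $3$ the walk succeeds (when $u$ has out-degree exactly $2$, $u$ is said to volunteer, taking on a secondary out-going edge), while if $u$ has out-degree $3$ the walk fails. Failed walks are restarted from scratch with fresh randomness, up to $d\log n$ attempts in total; if all fail, the algorithm declares failure and stops. After a successful walk ending at $u$, all edges of the walk from $v_1$ to $u$ are flipped, and $e_t$ is oriented out of $v_1$. An edge newly out-going from a vertex $w$ is primary, replacing a lost primary edge or filling a free primary place, except that the new out-going edge of a volunteering vertex is its secondary edge. *)

(* Defs.v *)
From mathcomp Require Import all_boot all_order all_algebra.

Set Implicit Arguments.
Unset Strict Implicit.
Unset Printing Implicit Defensive.

Definition lg (n : nat) : nat := trunc_log 2 n.
Definition lglg (n : nat) : nat := lg (lg n).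

(* An undirected edge {x, y} is given as a pair (x, y); the order of its
   components carries no information. *)
Definition adj (V : finType) (es : seq (V * V)) : rel V :=
  fun x y => ((x, y) \in es) || ((y, x) \in es).

Definition is_tree (V : finType) (es : seq (V * V)) : Prop :=
  [/\ 0 < #|V|,
      all (fun e => e.1 != e.2) es
        && uniq [seq [set e.1; e.2] | e : V * V <- es],
      forall x y : V, connect (adj es) x y
    & forall p : seq V, 2 < size p -> ~ ucycle (adj es) p].

(* Cells [out s v i] with [i < deg s v] hold the heads of the out-going edges
   of [v]; cells of larger index are unused.  Cells 0 and 1 are the two primary
   places, cell 2 is the secondary place.  [par] and [sz] are the arrays of a
   union-find structure; [sz] is meaningful at roots only.
   Nothing in the type bounds [deg]. *)
Record state (V : finType) := State {
  out : V -> nat -> V;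
  deg : V -> nat;
  par : V -> V;
  sz  : V -> nat }.

Definition init (V : finType) : state V :=
  State (fun v _ => v) (fun=> 0) (fun v => v) (fun=> 1).

Definition outs (V : finType) (s : state V) (v : V) : seq V :=
  [seq out s v i | i <- iota 0 (deg s v)].

Definition outdeg (V : finType) (s : state V) (v : V) : nat := size (outs s v).

(* Every edge of [es] is directed in exactly one of the two possible ways, and
   no other edge is stored. *)
Definition is_orientation (V : finType) (es : seq (V * V)) (s : state V) : Prop :=
  forall x y : V,
    count_mem y (outs s x) + count_mem x (outs s y) = adj es x y.

(* Number of edges directed one way in [s] and the other way in [s']. *)
Definition flips (V : finType) (s s' : state V) : nat :=
  #|[set e : V * V | (e.2 \in outs s e.1) && (e.1 \in outs s' e.2)]|.

(* Unit-cost RAM computations: memory in, (result, memory, elapsed time) out.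
   Time passes only in the primitives below, one unit for each cell read or
   written and for each arithmetic operation, comparison, random bit, stack
   operation or loop-counter update ([alu]). *)
Definition ram (V : finType) (A : Type) : Type := state V -> A * state V * nat.

Definition ret (V : finType) (A : Type) (a : A) : ram V A := fun s => (a, s, 0).

Definition bind (V : finType) (A B : Type) (m : ram V A) (k : A -> ram V B) :
    ram V B :=
  fun s => let: (a, s1, t1) := m s in
           let: (b, s2, t2) := k a s1 in (b, s2, t1 + t2).

Notation "'let*' x ':=' m 'in' k" := (bind m (fun x => k))
  (at level 200, x name, m at level 200, k at level 200, right associativity).
Notation "m ';;' k" := (bind m (fun _ => k))
  (at level 199, k at level 200, right associativity).

Definition alu (V : finType) (A : Type) (a : A) : ram V A := fun s => (a, s, 1).
Definition read (V : finType) (A : Type) (f : state V -> A) : ram V A :=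
  fun s => (f s, s, 1).
Definition tick {V : finType} : ram V unit := alu tt.

Definition write_out (V : finType) (v : V) (i : nat) (x : V) : ram V unit :=
  fun s => (tt, State (fun w j => if (w == v) && (j == i) then x else out s w j)
                      (deg s) (par s) (sz s), 1).
Definition write_deg (V : finType) (v : V) (k : nat) : ram V unit :=
  fun s => (tt, State (out s) (fun w => if w == v then k else deg s w)
                      (par s) (sz s), 1).
Definition write_par (V : finType) (v p : V) : ram V unit :=
  fun s => (tt, State (out s) (deg s) (fun w => if w == v then p else par s w)
                      (sz s), 1).
Definition write_sz (V : finType) (v : V) (k : nat) : ram V unit :=
  fun s => (tt, State (out s) (deg s) (par s)
                      (fun w => if w == v then k else sz s w), 1).

(* Union by size without path compression.  The argument [fuel] only serves
   termination: [uf_find] is called with [fuel = #|V|], which exceeds the length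
   of every chain of parents. *)
Fixpoint uf_find (V : finType) (fuel : nat) (v : V) : ram V V :=
  let* p := read (fun s => par s v) in
  let* root := alu (p == v) in
  if root then ret v else
  if fuel is fuel'.+1 then uf_find fuel' p else ret v.

Definition uf_unite (V : finType) (r1 r2 : V) (n1 n2 : nat) : ram V unit :=
  write_par r1 r2 ;; let* n := alu (n1 + n2) in write_sz r2 n.

(* One attempt, standing at [u] with random bits [bits] left, one per remaining
   move.  [path] is the stack of the edges traversed so far, the latest on top;
   [(w, b)] stands for the edge that was stored in cell [b] of [w].  A success
   returns the final vertex and the stack.  Bits that remain when the walk ends
   early are never used again. *)
Fixpoint walk (V : finType) (bits : seq bool) (u : V) (path : seq (V * bool)) :
    ram V (option (V * seq (V * bool))) :=
  let* k := read (fun s => deg s u) in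
  let* free := alu (k < 2) in
  if free then ret (Some (u, path)) else
  tick ;;
  match bits with
  | [::] => let* ok := alu (k < 3) in ret (if ok then Some (u, path) else None)
  | b0 :: bits' =>
      let* b := alu b0 in
      let* w := read (fun s => out s u b) in
      tick ;; walk bits' w ((u, b) :: path)
  end.

Fixpoint attempts (V : finType) (L : nat) (coins : seq (L.-tuple bool)) (v : V) :
    ram V (option (V * seq (V * bool))) :=
  tick ;;
  if coins is bits :: coins' then
    let* r := walk bits v [::] in
    if r is Some _ then ret r else attempts coins' v
  else ret None.

(* The tail of the topmost edge of the stack, or [v2] if there is none: the
   head that the next edge to be written must receive. *)
Definition new_head (V : finType) (v2 : V) (path : seq (V * bool)) : V :=
  if path is (w, _) :: _ then w else v2.

Fixpoint flip_path (V : finType) (v2 : V) (path : seq (V * bool)) : ram V unit :=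
  tick ;;
  if path is (w, b) :: path' then
    let* x := alu (new_head v2 path') in
    write_out w b x ;; flip_path v2 path'
  else ret tt.

(* The new edge goes into a free primary place if [deg s u < 2] and into the
   secondary place if [deg s u = 2]. *)
Definition add_out (V : finType) (u x : V) : ram V unit :=
  let* k := read (fun s => deg s u) in
  write_out u k x ;;
  let* k' := alu k.+1 in
  write_deg u k'.

(* Arrival of the edge {a, b}; [tie] decides which tree is called T1 when both
   have the same size.  The result tells whether the edge was inserted. *)
Definition step (V : finType) (K L : nat) (tie : state V -> bool)
    (coins : K.-tuple (L.-tuple bool)) (a b : V) : ram V bool :=
  let* ra := uf_find #|V| a in
  let* rb := uf_find #|V| b in
  let* na := read (fun s => sz s ra) in
  let* nb := read (fun s => sz s rb) in
  let* lt := alu (na < nb) in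
  let* eq := alu (na == nb) in
  let* choice := read tie in
  let a_first := lt || eq && choice in
  let: (v1, v2) := if a_first then (a, b) else (b, a) in
  let: (r1, r2) := if a_first then (ra, rb) else (rb, ra) in
  let* r := attempts coins v1 in
  if r is Some (u, path) then
    let* x := alu (new_head v2 path) in
    add_out u x ;;
    flip_path v2 path ;;
    uf_unite r1 r2 na nb ;;
    ret true
  else ret false.

Record event (V : finType) := Event {
  ev_ok : bool;
  ev_before : state V;
  ev_after : state V;
  ev_time : nat }.

(* The log of the execution on the arrivals [es], numbered from [t]; it ends
   with the first arrival at which failure is declared. *)
Fixpoint run (V : finType) (K L : nat) (tie : nat -> state V -> bool) (t : nat)
    (es : seq (V * V)) (coins : seq (K.-tuple (L.-tuple bool))) (s : state V) :
    seq (event V) :=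
  match es, coins with
  | e :: es', w :: coins' =>
      let: (ok, s', time) := step (tie t) w e.1 e.2 s in
      Event ok s s' time :: (if ok then run tie t.+1 es' coins' s' else [::])
  | _, _ => [::]
  end.

(* All random bits used on an n-vertex input: for each of the n - 1 arrivals,
   [d * lg n] attempts of [c * lglg n] bits. *)
Definition tape (c d n : nat) : finType :=
  n.-1.-tuple ((d * lg n).-tuple ((c * lglg n).-tuple bool)).

Definition dancing_walk (c d : nat) (V : finType) (tie : nat -> state V -> bool)
    (es : seq (V * V)) (w : tape c d #|V|) : seq (event V) :=
  run tie 0 es w (init V).

Definition declares_failure (V : finType) (log : seq (event V)) : bool :=
  has (fun ev => ~~ ev_ok ev) log.

(* Uniform probability: the random bits are independent and fair. *)
Definition Pr (T : finType) (A : pred T) : rat := (#|A|%:R / #|T|%:R)%R.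

(* Main.v *)
Require Import Defs.
From mathcomp Require Import all_boot all_order all_algebra.
From mathcomp Require Import zify ring lra.

Set Implicit Arguments.
Unset Strict Implicit.
Unset Printing Implicit Defensive.

Import Order.TTheory GRing.Theory Num.Theory.

(* A vertex [v] lies in the smaller of the joined trees at most [lg n] times,
   and in such a step only the edge at [v] leading to the far end of [e_t] can
   be turned out of [v].  Hence, although the orientation is random, all heads
   that [v] ever has belong to a set [heads v] of size at most [lg n] that does
   not depend on the random bits, and the list of the [M = 2^(c lglg n)] ends
   of the full-length walks of a step belongs to a deterministic family of at
   most [n (lg n)^O(M)] lists.  As long as no step is bad, i.e. at most half of
   these ends have out-degree 3, each attempt succeeds with probability at
   least 1/2, and a given end volunteers with probability at most [2/M].  So
   a fixed list [A] acquires [O(lg n)] volunteers on average, and the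
   probability that half of it volunteers is so small, [(lg n)^(-Omega(c M))],
   that a union bound over the family applies.  The union bound is carried out
   with the sum [Phi] over the family of the exponential moments of the number
   of volunteers, a supermartingale until the first bad step. *)

(** * Forests *)

Lemma leq_card_bigcup (T I : finType) (B : I -> {set T}) :
  #|\bigcup_i B i| <= \sum_i #|B i|.
Proof.
apply: (big_ind2 (fun (A : {set T}) n => #|A| <= n)) => //; first by rewrite cards0.
by move=> A m B' n hA hB; rewrite cardsU (leq_trans (leq_subr _ _)) ?leq_add.
Qed.

Section Forest.
Variable V : finType.
Implicit Types (F es : seq (V * V)) (a b v w x y : V) (p : seq V).

Lemma adj_sym F : symmetric (adj F).
Proof. by move=> x y; rewrite /adj orbC. Qed.

Lemma conn_sym F : connect_sym (adj F).
Proof. exact/sym_connect_sym/adj_sym. Qed.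

Lemma adj_sub F es : {subset F <= es} -> subrel (adj F) (adj es).
Proof. by move=> sub x y /orP[] /sub h; rewrite /adj h ?orbT. Qed.

Lemma adj_cat F es x y : adj (F ++ es) x y = adj F x y || adj es x y.
Proof. by rewrite /adj !mem_cat orbACA. Qed.

Lemma adj_edge a b x y :
  adj [:: (a, b)] x y = (x == a) && (y == b) || (x == b) && (y == a).
Proof. by rewrite /adj !inE !xpair_eqE [(y == a) && _]andbC. Qed.

Definition simple_edges es :=
  all (fun e => e.1 != e.2) es && uniq [seq [set e.1; e.2] | e : V * V <- es].

Definition acyclic es := forall p, 2 < size p -> ~ ucycle (adj es) p.

Lemma adj_irr es : simple_edges es -> irreflexive (adj es).
Proof.
by case/andP=> /allP loopless _ x; apply/negP => /orP[] /loopless; rewrite eqxx.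
Qed.

Lemma fresh_edge F a b es : simple_edges (F ++ (a, b) :: es) ->
  a != b /\ ~~ adj F a b.
Proof.
rewrite /simple_edges all_cat map_cat cat_uniq /=.
case/andP=> /and3P[_ -> _] /and3P[_ /norP[nF _] _]; split=> //.
apply: contra nF => /orP[] h; apply/mapP; first by exists (a, b).
by exists (b, a); rewrite //= setUC.
Qed.

(** A return of the path to its first vertex [x] would close a cycle of [es]. *)
Lemma uniq_dipath es (R : rel V) : simple_edges es -> acyclic es ->
  subrel R (adj es) -> (forall x y, R x y -> ~~ R y x) ->
  forall p x, path R x p -> uniq (x :: p).
Proof.
move=> sim acy sub asym; elim=> // w p IH x /= /andP[xw wp].
have := IH _ wp; rewrite cons_uniq => /andP[wNp uniq_p].
rewrite wNp uniq_p !andbT inE negb_or.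
have xw' : x != w by apply/eqP => e; have := sub _ _ xw; rewrite e (adj_irr sim).
rewrite xw' /=; apply/negP => xp.
case/splitPr: xp wp wNp uniq_p => p1 p2.
rewrite cat_path mem_cat cat_uniq /= => /and3P[wp1 last_x _].
rewrite negb_or => /andP[wNp1 _] /and3P[uniq1 /norP[xNp1 _] _].
(* Asymmetry rules out the return [x], [w], [x], so the cycle has the three vertices that [acyclic]
   asks for. *)
have [z [p1' def_p1]] : exists z p1', p1 = z :: p1'.
  case: p1 {wp1 wNp1 uniq1 xNp1} last_x => [|z p1' _]; last by exists z, p1'.
  by move=> wx; move: (asym _ _ xw); rewrite wx.
apply: (acy [:: x, w & p1]); first by rewrite def_p1.
rewrite /ucycle /= rcons_path (sub_path sub wp1) sub //= (sub _ _ last_x).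
by rewrite inE negb_or xw' wNp1 xNp1.
Qed.

Definition avoid es v : rel V :=
  fun x y => [&& adj es x y, x != v & y != v].

(** The next vertex on the path from [v] to [y], as a set, so that no path has to exist; acyclicity
    makes it at most a singleton. *)
Definition toward es v y := [set w | adj es v w && connect (avoid es v) w y].

Lemma avoid_sym es v : connect_sym (avoid es v).
Proof.
by apply: sym_connect_sym => x y; rewrite /avoid adj_sym; congr (_ && _); rewrite andbC.
Qed.

(** Two different such neighbours would be joined by a path avoiding [v], which [v] closes to a
    cycle. *)
Lemma towardP es v y w w' : acyclic es -> simple_edges es ->
  w \in toward es v y -> w' \in toward es v y -> w = w'.
Proof.
move=> acy sim; rewrite !inE => /andP[vw wy] /andP[vw' w'y].
have [//|ne] := eqVneq w w'.
have /connectP[p0 p0P p0l] : connect (avoid es v) w w'.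
  by apply: connect_trans wy _; rewrite avoid_sym.
move: p0l; case/shortenP: p0P => p pP uniq_p _ last_p.
have vNp : v \notin p.
  apply/negP => vp; case/splitPr: vp pP => p1 p2.
  by rewrite cat_path /= => /and3P[_ /and3P[_ _]]; rewrite eqxx.
have wv : v != w by apply/eqP => e; move: vw; rewrite e adj_irr.
case: p => [|z p] in pP uniq_p last_p vNp *; first by move: ne; rewrite last_p eqxx.
case: (acy [:: v, w, z & p]) => //.
rewrite /ucycle cons_uniq uniq_p inE negb_or wv vNp !andbT /cycle rcons_path /= vw.
have sub : subrel (avoid es v) (adj es) by move=> ? ? /and3P[].
have /= -> := sub_path sub pP.
by rewrite adj_sym -[last z p]/(last w (z :: p)) -last_p.
Qed.

Lemma card_toward es v y : acyclic es -> simple_edges es ->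
  #|toward es v y| <= 1.
Proof.
move=> acy sim; apply/card_le1_eqP => w w' hw hw'.
exact: (towardP acy sim hw' hw).
Qed.

Lemma conn_cat F es x y :
  connect (adj F) x y -> connect (adj (F ++ es)) x y.
Proof.
by apply: connect_sub => {}x {}y xy; apply: connect1; rewrite adj_cat xy.
Qed.

(** A path of [F] between the ends would close up with the new edge to a cycle; it has at least two
    edges because the new edge is not in [F]. *)
Lemma joins_trees F a b es :
  simple_edges (F ++ (a, b) :: es) -> acyclic (F ++ (a, b) :: es) ->
  ~~ connect (adj F) a b.
Proof.
move=> sim acy; have [ab nF] := fresh_edge sim.
apply/negP => /connectP[p0 p0P p0l]; move: p0l.
case/shortenP: p0P => p pP uniq_p _ last_p.
case: p => [|z [|z' p]] in pP uniq_p last_p *.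
- by move: ab; rewrite last_p eqxx.
- by move: pP nF => /=; rewrite last_p /= andbT => ->.
apply: (acy [:: a, z, z' & p]) => //.
rewrite /ucycle uniq_p andbT /cycle rcons_path.
have sub : subrel (adj F) (adj (F ++ (a, b) :: es)).
  by move=> ? ? h; rewrite adj_cat h.
rewrite (sub_path sub pP) -last_p adj_sym adj_cat -cat1s adj_cat adj_edge !eqxx /=.
by rewrite orbT.
Qed.

Definition tree F x := [set y | connect (adj F) x y].

(** A second crossing of the new edge leads back to an end already visited, so one crossing is
    enough. *)
Lemma connect_rcons F a b x y :
  connect (adj (rcons F (a, b))) x y =
  [|| connect (adj F) x y,
      connect (adj F) x a && connect (adj F) b y
    | connect (adj F) x b && connect (adj F) a y].
Proof.
have sub x' y' : connect (adj F) x' y' -> connect (adj (rcons F (a, b))) x' y'.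
  by rewrite -cats1; apply: conn_cat.
have ab : connect (adj (rcons F (a, b))) a b.
  by apply: connect1; rewrite -cats1 adj_cat adj_edge !eqxx orbT.
apply/idP/idP; last first.
  case/or3P=> [/sub //|/andP[/sub xa /sub by_]|/andP[/sub xb /sub ay]].
    exact: connect_trans xa (connect_trans ab by_).
  by apply: connect_trans xb (connect_trans _ ay); rewrite conn_sym.
case/connectP=> p; elim: p x => [|z p IH] x /=; first by move=> _ ->; rewrite connect0.
case/andP=> xz /IH {}IH /IH {IH}.
move: xz; rewrite -cats1 adj_cat adj_edge => /or3P[/connect1 xz| |].
- case/or3P=> [h|/andP[h ->]|/andP[h ->]]; rewrite (connect_trans xz h) ?orbT //.
- case/andP=> /eqP-> /eqP->; case/or3P=> [->|/andP[h1 h2]|/andP[h1 ->]].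
  + by rewrite connect0 orbT.
  + by rewrite connect0 h2 orbT.
  + by [].
- case/andP=> /eqP-> /eqP->; case/or3P=> [->|/andP[h1 ->]|/andP[h1 h2]].
  + by rewrite connect0 !orbT.
  + by [].
  + by rewrite connect0 h2 !orbT.
Qed.

Lemma tree_eq F x y : connect (adj F) x y -> tree F x = tree F y.
Proof.
by move=> xy; apply/setP => z; rewrite !inE (same_connect (conn_sym F) xy).
Qed.

Lemma tree_rcons F a b x : connect (adj F) x a ->
  tree (rcons F (a, b)) x = tree F a :|: tree F b.
Proof.
move=> xa; apply/setP => y; rewrite !inE connect_rcons xa /=.
rewrite (same_connect (conn_sym F) xa).
by case: (connect _ a y) => //=; rewrite andbF orbF.
Qed.

Lemma tree_rconsr F a b x : connect (adj F) x b ->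
  tree (rcons F (a, b)) x = tree F a :|: tree F b.
Proof.
move=> xb; apply/setP => y; rewrite !inE connect_rcons xb /=.
rewrite (same_connect (conn_sym F) xb).
by case: (connect _ b y); rewrite ?andbT ?andbF ?orbT ?orbF.
Qed.

Lemma card_join F a b : ~~ connect (adj F) a b ->
  #|tree F a :|: tree F b| = #|tree F a| + #|tree F b|.
Proof.
move=> nab; rewrite cardsU; suff -> : tree F a :&: tree F b = set0.
  by rewrite cards0 subn0.
apply/setP => y; rewrite !inE; apply: contraNF nab => /andP[ay by_].
by apply: connect_trans ay _; rewrite conn_sym.
Qed.

Lemma tree_other F a b x :
  ~~ connect (adj F) x a -> ~~ connect (adj F) x b ->
  tree (rcons F (a, b)) x = tree F x.
Proof.
by move=> xa xb; apply/setP => y; rewrite !inE connect_rcons (negPf xa) (negPf xb) !orbF.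
Qed.

Lemma tree_mono F e x : tree F x \subset tree (rcons F e) x.
Proof. by apply/subsetP => y; rewrite !inE -cats1; apply: conn_cat. Qed.

(** The comparison is not strict: with equal sizes either tree may be taken as T1, so both count as
    small and the tie-breaking does not matter. *)
Definition in_small F a b x :=
  connect (adj F) x a && (#|tree F a| <= #|tree F b|).

Definition moved F (e : V * V) x :=
  in_small F e.1 e.2 x || in_small F e.2 e.1 x.

Lemma moved_double F e x : ~~ connect (adj F) e.1 e.2 -> moved F e x ->
  2 * #|tree F x| <= #|tree (rcons F e) x|.
Proof.
case: e => a b /= nab /orP[] /andP[/= h le].
  by rewrite (tree_rcons _ h) card_join // (tree_eq h) mul2n -addnn leq_add2l.
by rewrite (tree_rconsr _ h) card_join // (tree_eq h) mul2n -addnn leq_add2r.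
Qed.

Definition moved_at es r x := moved (take r es) (nth (x, x) es r) x.

Lemma joins_at es r x : simple_edges es -> acyclic es -> r < size es ->
  ~~ connect (adj (take r es)) (nth (x, x) es r).1 (nth (x, x) es r).2.
Proof.
move=> sim acy lt; have := cat_take_drop r es; rewrite (drop_nth (x, x) lt).
case: (nth _ _ _) => a b /= E; apply: (@joins_trees _ _ _ (drop r.+1 es)); by rewrite E.
Qed.

(** Every move at least doubles the tree of [x], whose size never exceeds [#|V|]. *)
Lemma moved_count es x : simple_edges es -> acyclic es ->
  \sum_(r < size es) moved_at es r x <= lg #|V|.
Proof.
move=> sim acy.
suff H t : t <= size es ->
    2 ^ (\sum_(r < t) moved_at es r x) <= #|tree (take t es) x|.
  apply: trunc_log_max => //; apply: leq_trans (H _ (leqnn _)) _.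
  exact: max_card.
elim: t => [_|t IH lt].
  by rewrite big_ord0 expn0 card_gt0; apply/set0Pn; exists x; rewrite inE connect0.
rewrite big_ord_recr /= (take_nth (x, x)) // addnC expnD.
apply: leq_trans (_ : 2 ^ moved_at es t x * #|tree (take t es) x| <= _).
  by rewrite leq_mul2l IH ?orbT // ltnW.
case E: (moved_at es t x); last by rewrite expn0 mul1n subset_leq_card // tree_mono.
by rewrite expn1 moved_double // joins_at.
Qed.

(* Every vertex that may ever become the head of an edge out of [v]: the walk
   of step [r] can only turn towards the far end of [e_r] an edge at a vertex
   of the smaller tree. *)
Definition heads es v : {set V} :=
  \bigcup_(r < size es)
    let: F := take r es in let: e := nth (v, v) es r in
    ((if in_small F e.1 e.2 v then toward es v e.2 else set0) :|:
     (if in_small F e.2 e.1 v then toward es v e.1 else set0)).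

(** A step adds at most one head, and only if it moves [v]: the edge joins two different trees, so
    at most one of the two sets in the union is nonempty. *)
Lemma card_heads es v : simple_edges es -> acyclic es ->
  #|heads es v| <= lg #|V|.
Proof.
move=> sim acy; apply: leq_trans (moved_count v sim acy).
apply: leq_trans (leq_card_bigcup _) _.
apply: leq_sum => r _; rewrite /moved_at /moved.
set e := nth _ _ _; have := joins_at v sim acy (ltn_ord r); rewrite -/e => nc.
case: ifP => /= [/andP[h1 _]|_].
  have -> : in_small (take r es) e.2 e.1 v = false.
    apply/negP => /andP[h2 _]; case/negP: nc.
    by apply: connect_trans h2; rewrite conn_sym.
  by rewrite setU0 card_toward.
case: ifP => _; by rewrite set0U ?cards0 ?card_toward.
Qed.

End Forest.

(** * Union-find, walks and flips *)

Section Machine.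
Variable V : finType.
Implicit Types (F es : seq (V * V)) (a b u v w x y r : V) (s : state V).
Implicit Types (path : seq (V * bool)).

(* Ranks are ghost data: they witness that chains of parents are short. *)
Definition uf_ranked F s (rk : V -> nat) :=
  [/\ forall v, par s v != v -> rk v < rk (par s v),
      forall v, connect (adj F) v (par s v),
      forall x y, par s x = x -> par s y = y -> connect (adj F) x y -> x = y,
      forall x, par s x = x -> sz s x = #|tree F x| /\ 2 ^ rk x <= #|tree F x|
    & forall v, rk v <= lg #|V|].

Definition uf_ok F s := exists rk, uf_ranked F s rk.

(** Ranks increase along parents and are at most [lg #|V|], so [lg #|V| - rk v] bounds the rest of
    the chain, at two time units per vertex. *)
Lemma uf_find_spec F s rk fuel v : uf_ranked F s rk -> lg #|V| <= fuel + rk v ->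
  exists r t, [/\ uf_find fuel v s = (r, s, t), par s r = r,
                  connect (adj F) v r & t <= 2 * (lg #|V| - rk v).+1].
Proof.
case=> mono conn _ _ le; elim: fuel v => [|fuel IH] v lefuel /=;
  rewrite /bind /read /alu /ret /=.
  have root : par s v = v.
    by apply/eqP; apply: contraLR lefuel => /mono h; rewrite add0n -ltnNge (leq_trans h).
  by exists v, 2; rewrite root eqxx /=; split=> //; lia.
case: ifPn => [/eqP root|/mono h]; first by exists v, 2; split=> //=; lia.
have [|r [t [-> pr cr lt]]] := IH (par s v); first by lia.
exists r, (2 + t); split=> //; first exact: connect_trans (conn v) cr.
by move: (le (par s v)) h lt; move: (rk v) (rk (par s v)) (lg _) => i j l; lia.
Qed.

Lemma lg_leq n : lg n <= n.
Proof.
case: n => // n; have /andP[h _] := trunc_log_bounds (isT : 1 < 2) (isT : 0 < n.+1).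
by apply: leq_trans h; rewrite ltnW // ltn_expl.
Qed.

Lemma uf_find_ok F s v : uf_ok F s ->
  exists r t, [/\ uf_find #|V| v s = (r, s, t), par s r = r,
                  connect (adj F) v r & t <= 2 * (lg #|V|).+1].
Proof.
case=> rk ok; have [|r [t [h1 h2 h3 h4]]] := uf_find_spec (fuel := #|V|) (v := v) ok.
  exact: leq_trans (lg_leq _) (leq_addr _ _).
by exists r, t; split=> //; lia.
Qed.

(** [s'] is the memory after the flips, which leave [par] and [sz] alone. The sizes enter through
    their sum because the step reads them in the order of the arriving pair. *)
Lemma uf_unite_ok F s a b r1 r2 n1 n2 s' :
  uf_ok F s -> ~~ connect (adj F) a b ->
  par s r1 = r1 -> par s r2 = r2 -> connect (adj F) a r1 -> connect (adj F) b r2 ->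
  sz s r1 <= sz s r2 -> n1 + n2 = sz s r1 + sz s r2 ->
  par s' = par s -> sz s' = sz s ->
  uf_ok (rcons F (a, b)) (uf_unite r1 r2 n1 n2 s').1.2.
Proof.
case=> rk [mono conn uniq_root root le] nab p1 p2 c1 c2 le12 n12 ps' ss'.
rewrite /uf_unite /bind /write_par /write_sz /alu /=.
have r12 : r1 != r2.
  by apply: contraNneq nab => e; rewrite (connect_trans c1) // conn_sym e.
have cr1 : #|tree F r1| = sz s r1 by have [] := root _ p1.
have cr2 : #|tree F r2| = sz s r2 by have [] := root _ p2.
have up x y : connect (adj F) x y -> connect (adj (rcons F (a, b))) x y.
  by rewrite -cats1; apply: conn_cat.
have cab : connect (adj (rcons F (a, b))) a b.
  by apply: connect1; rewrite -cats1 adj_cat adj_edge !eqxx orbT.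
have comp2 x : connect (adj F) x b ->
    #|tree (rcons F (a, b)) x| = sz s r1 + sz s r2.
  move=> xb; rewrite (tree_rconsr _ xb) card_join //.
  by rewrite (tree_eq c1) (tree_eq c2) cr1 cr2.
have rb : connect (adj F) r2 b by rewrite conn_sym.
have notr1 x : (if x == r1 then r2 else par s x) = x -> x != r1 /\ par s x = x.
  by case: eqP => [-> e|//]; rewrite e eqxx in r12.
have notb x : par s x = x -> x != r2 -> ~~ connect (adj F) x b.
  move=> px; apply: contraNN => xb; apply/eqP/uniq_root => //.
  exact: connect_trans xb c2.
have nota x : par s x = x -> x != r1 -> ~~ connect (adj F) x a.
  move=> px; apply: contraNN => xa; apply/eqP/uniq_root => //.
  exact: connect_trans xa c1.
(* If the new rank is [(rk r1).+1], then [2 * 2 ^ rk r1 <= 2 * sz s r1], and [r1] is the root of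
   smaller size. *)
have pow2 : 2 ^ (if rk r1 < rk r2 then rk r2 else (rk r1).+1) <= sz s r1 + sz s r2.
  have [_ h1] := root _ p1; have [_ h2] := root _ p2.
  case: ifP => _; rewrite ?expnS; lia.
exists (fun x => if x == r2 then (if rk r1 < rk r2 then rk r2 else (rk r1).+1) else rk x).
split=> /= [v|v|x y|x|v]; rewrite ?ps' ?ss'.
- have [->|v1] := eqVneq v r1.
    by rewrite eqxx (negPf r12) => _; case: ifP => //; lia.
  move=> pv; have := mono v pv; have [e|v2] := eqVneq v r2; first by move: pv;
    rewrite e p2 eqxx.
  by case: (eqVneq (par s v) r2) => [->|//]; case: ifP => //; lia.
- case: eqP => [->|_]; last exact: up.
  apply: connect_trans (up _ _ c2); apply: connect_trans cab.
  by apply: up; rewrite conn_sym.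
- move=> /notr1[x1 px] /notr1[y1 py]; rewrite connect_rcons.
  case/or3P=> [|/andP[xa _]|/andP[_ ay]]; first exact: uniq_root.
    by have := nota _ px x1; rewrite xa.
  by have := nota _ py y1; rewrite conn_sym ay.
- move=> /notr1[x1 px]; have [->|x2] := eqVneq x r2.
    by rewrite comp2 // n12; split.
  by rewrite tree_other ?nota ?notb //; exact: root.
- case: ifP => [_|//].
  apply: trunc_log_max => //; apply: leq_trans pow2 _.
  by rewrite -(comp2 _ rb) max_card.
Qed.

Lemma uf_init : uf_ok [::] (init V).
Proof.
have c x y : connect (adj [::]) x y -> x = y.
  by case/connectP=> -[|z p] //=.
exists (fun=> 0); split=> //= [v|x y _ _ /c //|x _].
  by rewrite eqxx.
suff -> : tree [::] x = [set x] by rewrite cards1.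
by apply/setP => y; rewrite !inE; apply/idP/eqP => [/c //|->].
Qed.

(** A walk only reads memory, so its result is a function of a fixed state; its cost is accounted
    for separately. *)
Definition wk s : seq bool -> V -> seq (V * bool) -> option (V * seq (V * bool)) :=
  fix wk bits u path :=
    if deg s u < 2 then Some (u, path) else
    if bits is b :: bits' then wk bits' (out s u b) ((u, b) :: path)
    else if deg s u < 3 then Some (u, path) else None.

Lemma walk_wk s bits u path :
  exists2 t, walk bits u path s = (wk s bits u path, s, t) & t <= 6 * size bits + 4.
Proof.
elim: bits u path => [|b bits IH] u path /=; rewrite /bind /read /alu /ret /tick /=.
  by case: ifP => _; eexists; (reflexivity || lia).
case: ifP => _; first by eexists; (reflexivity || lia).
by have [t -> le] := IH (out s u b) ((u, b) :: path); eexists; (reflexivity || lia).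
Qed.

Definition att L s : seq (L.-tuple bool) -> V -> option (V * seq (V * bool)) :=
  fix att coins v :=
    if coins is bits :: coins' then
      if wk s bits v [::] is Some r then Some r else att coins' v
    else None.

Lemma attempts_att L s (coins : seq (L.-tuple bool)) v :
  exists2 t, attempts coins v s = (att s coins v, s, t)
           & t <= (6 * L + 5) * size coins + 1.
Proof.
elim: coins => [|bits coins [t2 E2 le2]] /=; rewrite /bind /tick /alu /ret /=.
  by eexists; (reflexivity || lia).
have [t1 -> le1] := walk_wk s bits v [::].
rewrite size_tuple in le1.
case: (wk s bits v [::]) => [r|]; rewrite ?E2; eexists; (reflexivity || lia).
Qed.

(* [path] is the stack of a walk from [start u path] to [u]. *)
Fixpoint chain s u path : bool :=
  if path is (w, b) :: path' then
    [&& b < deg s w, out s w b == u & chain s w path']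
  else true.

Definition start u path := last u (unzip1 path).

Lemma wk_chain s bits u path u' path' :
  wk s bits u path = Some (u', path') -> chain s u path ->
  [/\ chain s u' path', start u' path' = start u path,
      size path' <= size path + size bits & deg s u' < 3].
Proof.
elim: bits u path => [|b bits IH] u path /=.
  case: ifP => [lt2|_]; last case: ifP => [lt3|//]; case=> <- <- ch;
    rewrite addn0; split=> //; exact: ltnW.
case: ifP => [lt2 [<- <-] ch|/negbT ge2 /IH].
  by split=> //; rewrite ?leq_addr // ltnW.
rewrite /= eqxx /= => h ch; have [|h1 h2 h3 h4] := h.
  by rewrite ch andbT; move: ge2; case: (b); lia.
by split=> //; lia.
Qed.

Lemma att_chain L s (coins : seq (L.-tuple bool)) v u path :
  att s coins v = Some (u, path) ->
  [/\ chain s u path, start u path = v, size path <= L & deg s u < 3].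
Proof.
elim: coins => //= bits coins IH.
case E: (wk s bits v [::]) => [[u' path']|//] [<- <-].
by have [//|h1 h2] := wk_chain E; rewrite size_tuple.
Qed.

(** * The effect of flips on the stored arcs *)

Definition put s v i z : state V := (write_out v i z s).1.2.

(** The displaced head is added on the left rather than subtracted on the right, so that such
    identities compose over [nat]. *)
Lemma count_put s v i z x y : i < deg s v ->
  count_mem y (outs (put s v i z) x) + ((x == v) && (y == out s v i)) =
  count_mem y (outs s x) + ((x == v) && (y == z)).
Proof.
move=> lt; rewrite /outs /put /=; have [->|ne] /= := eqVneq x v; last first.
  by rewrite (eq_map (g := out s x)).
rewrite !count_map.
have -> : iota 0 (deg s v) = iota 0 i ++ i :: iota i.+1 (deg s v - i.+1).
  by rewrite {1}(_ : deg s v = i + (deg s v - i.+1).+1) ?iotaD //; lia.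
have off (r : seq nat) : i \notin r ->
    count (preim (fun j => if true && (j == i) then z else out s v j) (pred1 y)) r =
    count (preim (out s v) (pred1 y)) r.
  move=> ir; apply: eq_in_count => j jr /=.
  by case: (eqVneq j i) => // e; rewrite -e jr in ir.
rewrite !count_cat /= !eqxx !off ?mem_iota; [|lia..].
rewrite /= [y == z]eq_sym [y == out _ _ _]eq_sym.
set k1 := count _ (iota 0 i); set k2 := count _ (iota i.+1 _).
by move: k1 k2 (nat_of_bool _) (nat_of_bool _) => k1 k2 n1 n2; lia.
Qed.

Definition both s x y := count_mem y (outs s x) + count_mem x (outs s y).

(** Contribution to [both] of a single stored arc from [p] to [q]; [is_orientation F s] says that
    [both s] agrees with [adj F]. *)
Definition delta p q x y : nat := ((x == p) && (y == q)) + ((x == q) && (y == p)).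

Lemma both_put s v i z x y : i < deg s v ->
  both (put s v i z) x y + delta v (out s v i) x y = both s x y + delta v z x y.
Proof.
move=> lt; have := count_put z x y lt; have := count_put z y x lt.
by rewrite /both /delta ![(x == _) && (y == v)]andbC; lia.
Qed.

Fixpoint fl v2 path s :=
  if path is (w, b) :: path' then fl v2 path' (put s w b (new_head v2 path')) else s.

Lemma flip_path_fl v2 path s :
  flip_path v2 path s = (tt, fl v2 path s, 3 * size path + 1).
Proof.
elim: path s => [|[w b] path IH] s //=.
rewrite /bind /tick /alu /=; rewrite IH /=; congr (_, _); lia.
Qed.

Lemma fl_const v2 path s :
  [/\ deg (fl v2 path s) = deg s, par (fl v2 path s) = par s
    & sz (fl v2 path s) = sz s].
Proof. by elim: path s => [|[w b] path IH] s //=;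
  have [-> -> ->] := IH (put s w b (new_head v2 path)). Qed.

Definition cells path : seq (V * nat) := [seq (p.1, nat_of_bool p.2) | p <- path].

Lemma fl_out v2 path s v i : (v, i) \notin cells path ->
  out (fl v2 path s) v i = out s v i.
Proof.
elim: path s => [|[w b] path IH] s //=; rewrite inE negb_or => /andP[ne /IH ->].
by rewrite /put /= -xpair_eqE ifN.
Qed.

(** Each head written is the [new_head] of a suffix of the stack, so it is enough to know [Q] at all
    suffixes. *)
Lemma fl_new (Q : V -> V -> Prop) v2 path s v i :
  (forall p1 w (b : bool) p2, path = p1 ++ (w, b) :: p2 -> Q w (new_head v2 p2)) ->
  out (fl v2 path s) v i = out s v i \/ Q v (out (fl v2 path s) v i).
Proof.
elim: path s => [|[w b] path IH] s HQ /=; first by left.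
have [|->|] := IH (put s w b (new_head v2 path)); [|rewrite /put /=|by right].
  by move=> p1 w' b' p2 E; apply: (HQ ((w, b) :: p1) w' b'); rewrite E.
case: ifP => [/andP[/eqP-> _]|_]; last by left.
by right; apply: (HQ [::] w b).
Qed.

Lemma chain_put s u path v i z : v \notin unzip1 path ->
  chain (put s v i z) u path = chain s u path.
Proof.
elim: path u => [|[w b] path IH] u //=; rewrite inE negb_or => /andP[ne /IH ->].
by rewrite [w == v]eq_sym (negPf ne).
Qed.

(* Rewriting one cell after the other moves a doubly directed edge down the
   stack until it becomes the new edge. *)
Lemma fl_both v2 path s u x y : chain s u path -> uniq (unzip1 path) ->
  both (fl v2 path s) x y + delta u (new_head v2 path) x y =
  both s x y + delta (start u path) v2 x y.
Proof.
elim: path s u => [|[w b] path IH] s u //= /and3P[lt /eqP E ch] /andP[wN un].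
have := both_put (new_head v2 path) x y lt.
have := IH (put s w b (new_head v2 path)) w; rewrite chain_put // => /(_ ch un).
rewrite E /start /= /delta.
by case: (x == w); case: (y == w); case: (x == u); case: (y == u); lia.
Qed.

Definition addo u z s : state V :=
  let s1 := put s u (deg s u) z in (write_deg u (deg s u).+1 s1).1.2.

Lemma add_outE u z s : add_out u z s = (tt, addo u z s, 4).
Proof. by []. Qed.

Lemma deg_addo u z s v : deg (addo u z s) v = deg s v + (v == u).
Proof. by rewrite /addo /=; case: eqP => [->|]; lia. Qed.

Lemma outs_addo u z s v :
  outs (addo u z s) v = if v == u then rcons (outs s v) z else outs s v.
Proof.
rewrite /outs deg_addo; case: eqP => [->|ne]; last first.
  by rewrite addn0; apply: eq_map => j; rewrite /addo /=; case: eqP.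
rewrite iotaD /= add0n map_cat cats1 /= /addo /= !eqxx /=; congr rcons.
by apply/eq_in_map => j; rewrite mem_iota => h; rewrite ifF //; lia.
Qed.

Lemma both_addo u z s x y : both (addo u z s) x y = both s x y + delta u z x y.
Proof.
have c x' y' : count_mem y' (outs (addo u z s) x') =
    count_mem y' (outs s x') + ((x' == u) && (y' == z)).
  rewrite outs_addo; case: eqP => _ /=; last by rewrite addn0.
  by rewrite -cats1 count_cat /= addn0 eq_sym.
by rewrite /both !c /delta [(x == z) && _]andbC; lia.
Qed.

Lemma out_addo u z s v i :
  out (addo u z s) v i = if (v == u) && (i == deg s u) then z else out s v i.
Proof. by []. Qed.

Definition ins v2 u path s := fl v2 path (addo u (new_head v2 path) s).

Definition upd v2 r1 r2 n1 n2 u path s := (uf_unite r1 r2 n1 n2 (ins v2 u path s)).1.2.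

End Machine.

(** * Invariants *)

Section Invariant.
Variables (V : finType) (es : seq (V * V)).
Implicit Types (F : seq (V * V)) (a b u v w x y r : V) (s : state V).
Implicit Types (path : seq (V * bool)).

(** The last clause confines the random orientation to sets that do not depend on the bits; the
    union bound rests on it. *)
Definition inv F s :=
  [/\ is_orientation F s, forall v, deg s v <= 3, uf_ok F s
    & forall v i, i < deg s v -> out s v i \in heads es v].

Definition darc s : rel V := fun x y => y \in outs s x.

Lemma outsP s x y : reflect (exists2 i, i < deg s x & out s x i = y) (y \in outs s x).
Proof.
apply: (iffP mapP) => [[i]|[i lt e]]; last by exists i; rewrite ?mem_iota.
by rewrite mem_iota => lt e; exists i.
Qed.

Lemma darc_adj F s x y : is_orientation F s -> darc s x y -> adj F x y.
Proof. by move=> /(_ x y); rewrite /darc -has_pred1 has_count;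
  case: (adj F x y) => //; lia. Qed.

Lemma darc_asym F s x y : is_orientation F s -> darc s x y -> ~~ darc s y x.
Proof.
by move=> /(_ x y); rewrite /darc -!has_pred1 !has_count; case: (adj F x y); lia.
Qed.

Lemma outs_uniq F s x : is_orientation F s -> uniq (outs s x).
Proof.
move=> ori; apply: count_mem_uniq => y.
by have := ori x y; rewrite -has_pred1 has_count; case: (adj F x y); lia.
Qed.

Lemma inv_init : inv [::] (init V).
Proof. by split=> //; exact: uf_init. Qed.

Lemma chain_addo s u0 z u path : chain s u path -> chain (addo u0 z s) u path.
Proof.
elim: path u => [//|[w b] p IH] u /and3P[lt /eqP E ch].
apply/and3P; split; last exact: IH.
  by rewrite deg_addo ltn_addr.
by rewrite out_addo E; case: ifP => // /andP[/eqP ew /eqP eb]; rewrite eb ew ltnn in lt.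
Qed.

Hypotheses (sim : simple_edges es) (acy : acyclic es).

Section Step.
Variables (F rest : seq (V * V)) (e : V * V) (s : state V) (v1 v2 : V).
Hypotheses (def_es : es = F ++ e :: rest) (invs : inv F s).
Hypotheses (e_v : e = (v1, v2) \/ e = (v2, v1)).

Let ori : is_orientation F s. Proof. by case: invs. Qed.

Lemma prefix_adj x y : adj F x y -> adj es x y.
Proof. by move=> h; rewrite def_es adj_cat h. Qed.

Lemma new_adj : adj es v1 v2.
Proof.
rewrite def_es adj_cat -cat1s adj_cat /adj !inE.
by case: e_v => ->; rewrite eqxx ?orbT.
Qed.

Lemma new_joins : ~~ connect (adj F) v1 v2.
Proof.
move: e_v sim acy; rewrite def_es => -[]-> h1 h2; first exact: joins_trees h1 h2.
by rewrite conn_sym; apply: joins_trees h1 h2.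
Qed.

Lemma new_fresh : v1 != v2 /\ ~~ adj F v1 v2.
Proof.
move: e_v sim; rewrite def_es => -[]-> /fresh_edge []; first by [].
by rewrite eq_sym adj_sym.
Qed.

(** The stack lists the walk from its end, hence the reversed arcs. *)
Lemma chain_path u path : chain s u path ->
  path.path (fun x y => darc s y x) u (unzip1 path).
Proof.
elim: path u => [|[w b] p IH] u //= /and3P[lt /eqP E /IH ->].
by rewrite andbT; apply/outsP; exists b.
Qed.

Lemma chain_uniq u path : chain s u path -> uniq (u :: unzip1 path).
Proof.
move/chain_path; apply: (uniq_dipath sim acy).
  by move=> x y /(darc_adj ori); rewrite adj_sym; apply: prefix_adj.
by move=> x y /(darc_asym ori).
Qed.

Lemma chain_conn u path : chain s u path -> connect (adj F) u (start u path).
Proof.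
move/chain_path => h; apply/connectP; exists (unzip1 path); last by [].
by apply: sub_path h => x y /(darc_adj ori); rewrite adj_sym.
Qed.

Lemma chain_avoid x u path : chain s u path -> start u path = v1 ->
  x \notin u :: unzip1 path -> x != v2 -> connect (avoid es x) u v2.
Proof.
move=> ch st xN x2; elim: path u ch st xN => [|[w b] p IH] u /=.
  move=> _; rewrite /start /= => -> /[!inE] xN; apply: connect1.
  by rewrite /avoid new_adj eq_sym xN eq_sym.
case/and3P=> lt /eqP E ch st; rewrite inE negb_or => /andP[xu xN].
apply: (connect_trans _ (IH _ ch st xN)); apply: connect1.
rewrite /avoid adj_sym prefix_adj; last by apply: (darc_adj ori); apply/outsP; exists b.
by move: xN; rewrite inE negb_or [u == x]eq_sym xu [w == x]eq_sym => /andP[].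
Qed.

(** From the new head the walk leads back to [v1] and then over the new edge to [v2], without
    meeting [u] again. *)
Lemma chain_toward u path : chain s u path -> start u path = v1 ->
  new_head v2 path \in toward es u v2.
Proof.
move=> ch st; have := chain_uniq ch; have cu := chain_conn ch; rewrite st in cu.
case: path ch st => [|[w b] p] /=.
  by move=> _; rewrite /start /= => -> _; rewrite inE new_adj connect0.
case/and3P=> lt /eqP E ch st /andP[uN _]; rewrite inE.
rewrite adj_sym prefix_adj /=; last by apply: (darc_adj ori); apply/outsP; exists b.
apply: (chain_avoid ch) => //.
by apply: contraNneq new_joins => <-; rewrite conn_sym.
Qed.

Hypothesis small : #|tree F v1| <= #|tree F v2|.

Lemma chain_small u path : chain s u path -> start u path = v1 ->
  in_small F v1 v2 u.
Proof. by move=> /chain_conn h st; rewrite /in_small small -st h. Qed.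

Lemma small_moved x : in_small F v1 v2 x -> moved_at es (size F) x.
Proof.
move=> h; rewrite /moved_at def_es take_size_cat // nth_cat ltnn subnn /= /moved.
by case: e_v => -> /=; rewrite h ?orbT.
Qed.

Lemma small_heads u w : in_small F v1 v2 u -> w \in toward es u v2 ->
  w \in heads es u.
Proof.
move=> h wt; have lt : size F < size es by rewrite def_es size_cat /= -addn1 leq_add2l.
apply/bigcupP; exists (Ordinal lt) => //=.
have -> : take (size F) es = F by rewrite def_es take_size_cat.
have -> : nth (u, u) es (size F) = e by rewrite def_es nth_cat ltnn subnn.
by case: e_v => -> /=; rewrite h inE wt ?orbT.
Qed.

(** Each suffix of the stack is itself a walk from [v1], ending at [w]. *)
Lemma suffix_heads u path : chain s u path -> start u path = v1 ->
  forall p1 w (b : bool) p2, path = p1 ++ (w, b) :: p2 ->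
  new_head v2 p2 \in heads es w.
Proof.
move=> ch st p1 w b p2 E; rewrite {}E in ch st.
elim: p1 u ch st => [|[w' b'] p1 IH] u /= /and3P[_ _ ch]; last exact: IH.
by rewrite /start /= => st; apply: small_heads (chain_small ch st) (chain_toward ch st).
Qed.

Variables (r1 r2 : V) (n1 n2 : nat).

Lemma deg_upd u path v : deg (upd v2 r1 r2 n1 n2 u path s) v = deg s v + (v == u).
Proof.
rewrite /upd /ins /=; have [-> _ _] := fl_const v2 path (addo u (new_head v2 path) s).
exact: deg_addo.
Qed.

Lemma both_upd u path x y : chain s u path -> start u path = v1 ->
  both (upd v2 r1 r2 n1 n2 u path s) x y = both s x y + delta v1 v2 x y.
Proof.
move=> ch st; have un := chain_uniq ch; have [uN un'] := andP un.
rewrite -[LHS]/(both (ins v2 u path s) x y).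
have ch' : chain (addo u (new_head v2 path) s) u path.
  exact: chain_addo.
(* The arc that [add_out] stores at [u] cancels against the term at [u] in [fl_both]; only the new
   edge remains. *)
have := fl_both v2 x y ch' un'; rewrite both_addo st -/(ins v2 u path s).
by rewrite addnAC => /addIn.
Qed.

Lemma upd_inv u path : chain s u path -> start u path = v1 -> deg s u < 3 ->
  uf_ok (rcons F e) (upd v2 r1 r2 n1 n2 u path s) ->
  inv (rcons F e) (upd v2 r1 r2 n1 n2 u path s).
Proof.
move=> ch st lt3 ufok; have [_ le3 _ hd] := invs; split=> // [x y|v|v i].
- rewrite -[LHS]/(both _ x y) both_upd // [both s x y]ori.
  have [v12 nF] := new_fresh.
  have -> : adj (rcons F e) x y = adj F x y || (x == v1) && (y == v2) || (x ==
    v2) && (y == v1).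
    rewrite -cats1 adj_cat -orbA; congr (_ || _).
    by case: e_v => ->; rewrite adj_edge // orbC.
  rewrite /delta; case: (boolP ((x == v1) && (y == v2))) => [/andP[/eqP-> /eqP->]|_].
    by rewrite (negPf nF) (negPf v12).
  case: (boolP ((x == v2) && (y == v1))) => [/andP[/eqP-> /eqP->]|_].
    by rewrite adj_sym (negPf nF).
  by rewrite !orbF !addn0.
- by rewrite deg_upd; case: eqP => [->|_]; rewrite ?addn0 ?addn1.
- rewrite deg_upd => lt.
  have hu : new_head v2 path \in heads es u.
    exact: small_heads (chain_small ch st) (chain_toward ch st).
  rewrite -[out _ v i]/(out (ins v2 u path s) v i).
  have [|->|//] := @fl_new _ (fun x y => y \in heads es x) v2 path
     (addo u (new_head v2 path) s) v i; first exact: suffix_heads ch st.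
  rewrite out_addo; case: ifP => [/andP[/eqP-> _] //|ne]; apply: hd.
  by move: lt ne; case: eqP => [->|_] /=; lia.
Qed.

(** A flipped edge occupies a rewritten cell of its new tail: an untouched cell would direct the
    edge both ways in [s]. The rewritten cells are those of the stack and the new one at [u]. *)
Lemma flips_upd u path : chain s u path -> start u path = v1 ->
  flips s (upd v2 r1 r2 n1 n2 u path s) <= (size path).+1.
Proof.
move=> ch st; set s' := upd _ _ _ _ _ _ _ _.
pose C := (u, deg s u) :: cells path.
have -> : (size path).+1 = size [seq (out s' c.1 c.2, c.1) | c <- C].
  by rewrite size_map /= size_map.
apply: leq_trans (card_size _); apply/subset_leq_card/subsetP => -[x y].
rewrite inE /= => /andP[xy /outsP[i]]; rewrite deg_upd => lt E.
have [inC|] := boolP ((y, i) \in C).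
  by rewrite -E; apply: (map_f (fun c => (out s' c.1 c.2, c.1)) inC).
rewrite inE negb_or xpair_eqE => /andP[nu nc].
have: darc s y x; last by rewrite (negPf (darc_asym ori xy)).
apply/outsP; exists i; first by move: lt nu; case: eqP => [->|_] /=; lia.
by rewrite -E -[RHS]/(out (ins v2 u path s) y i) fl_out // out_addo (negPf nu).
Qed.

End Step.
End Invariant.

(** * One arrival *)

Section StepSpec.
Variable V : finType.
Implicit Types (F es : seq (V * V)) (s : state V) (tie : state V -> bool).

(** Needed when the smaller tree contains the second component, as [uf_unite_ok] then speaks of the
    reversed pair. *)
Lemma uf_ok_ext F F' s : adj F =2 adj F' -> uf_ok F s -> uf_ok F' s.
Proof.
move=> E [rk [h1 h2 h3 h4 h5]]; have Ec := eq_connect E.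
exists rk; split=> // [v|x y px py|x px]; rewrite -?Ec; [exact: h2|exact: h3|].
suff <- : tree F x = tree F' x by exact: h4.
by apply/setP => y; rewrite !inE Ec.
Qed.

Record step_data es F (e : V * V) s (v1 v2 r1 r2 : V) (n1 n2 : nat) : Prop := StepData {
  step_ends : e = (v1, v2) \/ e = (v2, v1);
  step_small : #|tree F v1| <= #|tree F v2|;
  step_inv : forall u path, chain s u path -> start u path = v1 -> deg s u < 3 ->
    inv es (rcons F e) (upd v2 r1 r2 n1 n2 u path s) }.

Definition step_result L (v1 v2 r1 r2 : V) n1 n2 (coins : seq (L.-tuple bool)) s :=
  if att s coins v1 is Some (u, path) then (true, upd v2 r1 r2 n1 n2 u path s)
  else (false, s).

(** Two finds, [K] walks of [L] moves, [L] flips at three units each, and constant overhead. *)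
Definition step_time n K L := 4 * lg n + (6 * L + 5) * K + 3 * L + 20.

(** The trees are named before any random bit is read, so the witnesses precede [coins]; this allows
    summing over the bits of the step later. *)
Lemma step_spec es F e rest s tie : simple_edges es -> acyclic es ->
  es = F ++ e :: rest -> inv es F s ->
  exists v1 v2 r1 r2 n1 n2, step_data es F e s v1 v2 r1 r2 n1 n2 /\
  forall K L (coins : K.-tuple (L.-tuple bool)),
  exists2 t, step tie coins e.1 e.2 s = (step_result v1 v2 r1 r2 n1 n2 coins s, t)
           & t <= step_time #|V| K L.
Proof.
case: e => a b sim acy def_es invs; have [_ _ ufs _] := invs.
have [ra [ta [Ea pa ca la]]] := uf_find_ok a ufs.
have [rb [tb [Eb pb cb lb]]] := uf_find_ok b ufs.
have nab : ~~ connect (adj F) a b.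
  by rewrite def_es in sim acy; exact: joins_trees sim acy.
have [sa sb] : sz s ra = #|tree F a| /\ sz s rb = #|tree F b|.
  case: ufs => rk [_ _ _ root _]; have [-> _] := root _ pa; have [-> _] := root _ pb.
  by rewrite (tree_eq ca) (tree_eq cb).
pose first := (sz s ra < sz s rb) || (sz s ra == sz s rb) && tie s.
have tail v1 v2 r1 r2 K L (coins : K.-tuple (L.-tuple bool)) :
  exists2 t,
    (let* r := attempts coins v1 in
     if r is Some (u, path) then
       let* x := alu (new_head v2 path) in
       add_out u x ;; flip_path v2 path ;;
       uf_unite r1 r2 (sz s ra) (sz s rb) ;; ret true
     else ret false) s =
    (step_result v1 v2 r1 r2 (sz s ra) (sz s rb) coins s, t)
  & t <= (6 * L + 5) * K + 3 * L + 10.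
  rewrite /step_result /bind; have [t -> let_] := attempts_att s coins v1.
  rewrite size_tuple in let_.
  case E: (att s coins v1) => [[u path]|]; last by eexists; (reflexivity || rewrite /=; lia).
  have [_ _ szp _] := att_chain E.
  rewrite /alu add_outE flip_path_fl /=.
  by eexists; (reflexivity || rewrite /=; lia).
have stepE K L (coins : K.-tuple (L.-tuple bool)) : exists2 t,
    step tie coins a b s =
      (if first then step_result a b ra rb (sz s ra) (sz s rb) coins s
       else step_result b a rb ra (sz s ra) (sz s rb) coins s, t)
    & t <= step_time #|V| K L.
  rewrite /step {1}/bind Ea {1}/bind Eb {1}/bind /read.
  rewrite {1}/bind {1}/bind {1}/alu {1}/bind {1}/alu {1}/bind -/first.
  case: first.
  - have [t -> let_] := tail a b ra rb K L coins.
    case: (step_result _ _ _ _ _ _ _ _) => ok s' /=.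
    eexists; first reflexivity.
    by rewrite /step_time; move: ((6 * L + 5) * K) (lg _) la lb let_ => m l la lb let_; lia.
  - have [t -> let_] := tail b a rb ra K L coins.
    case: (step_result _ _ _ _ _ _ _ _) => ok s' /=.
    eexists; first reflexivity.
    by rewrite /step_time; move: ((6 * L + 5) * K) (lg _) la lb let_ => m l la lb let_; lia.
have [le_ab|le_ba] : first /\ sz s ra <= sz s rb \/ ~~ first /\ sz s rb <= sz s ra.
  by rewrite /first; case: (ltngtP (sz s ra) (sz s rb)) => _ /=; case: (tie s); auto.
- exists a, b, ra, rb, (sz s ra), (sz s rb); case: le_ab => f le; split; last first.
    by move=> K L coins; have [t E lt] := stepE K L coins; exists t; rewrite // E f.
  split; [by left | by rewrite -sa -sb |] => u path ch st lt3.
  apply: (upd_inv (v1 := a) sim acy def_es invs) => //; [by left | by rewrite -sa -sb |].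
  have [_ p s_] := fl_const b path (addo u (new_head b path) s).
  exact: (uf_unite_ok ufs nab pa pb).
- exists b, a, rb, ra, (sz s ra), (sz s rb); case: le_ba => /negPf f le; split; last first.
    by move=> K L coins; have [t E lt] := stepE K L coins; exists t; rewrite // E f.
  split; [by right | by rewrite -sa -sb |] => u path ch st lt3.
  apply: (upd_inv (v1 := b) sim acy def_es invs) => //; [by right | by rewrite -sa -sb |].
  have [_ p s_] := fl_const a path (addo u (new_head a path) s).
  apply: (@uf_ok_ext (rcons F (b, a))).
    by move=> x y; rewrite -!cats1 !adj_cat !adj_edge; congr (_ || _); rewrite orbC.
  rewrite conn_sym in nab.
  by apply: (uf_unite_ok ufs nab pb pa) => //; rewrite addnC.
Qed.

End StepSpec.

(** * Whole executions *)

Section Run.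
Variables (V : finType) (es : seq (V * V)).
Hypotheses (sim : simple_edges es) (acy : acyclic es).
Implicit Types (F rest : seq (V * V)) (s : state V).

Lemma run_events K L tie t F rest (coins : seq (K.-tuple (L.-tuple bool))) s i :
  es = F ++ rest -> inv es F s ->
  i < size (run tie t rest coins s) ->
  let ev := nth (Event false (init V) (init V) 0) (run tie t rest coins s) i in
  [/\ ev_ok ev -> is_orientation (take (size F + i).+1 es) (ev_after ev),
      forall v, outdeg (ev_after ev) v <= 3,
      flips (ev_before ev) (ev_after ev) <= L.+1
    & ev_time ev <= step_time #|V| K L].
Proof.
elim: rest t F coins s i => [|e rest IH] t F [|w coins] s i // def_es invs.
have [v1 [v2 [r1 [r2 [n1 [n2 [[e_v small inv'] step']]]]]]] :=
  step_spec (tie t) sim acy def_es invs.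
have [time E let_] := step' K L w; rewrite /= E /step_result.
have odeg s' v : outdeg s' v = deg s' v by rewrite /outdeg size_map size_iota.
have cat_es : es = rcons F e ++ rest by rewrite cat_rcons.
case Ea: (att s w v1) => [[u path]|]; last first.
  have [ori le3 _ _] := invs.
  case: i => //= _; split=> // [v|]; first by rewrite odeg.
  (* A declared failure leaves the state unchanged, and no edge is directed both ways. *)
  rewrite /flips; apply: leq_trans (_ : #|(set0 : {set V * V})| <= _); last by rewrite cards0.
  apply/subset_leq_card/subsetP => -[x y]; rewrite inE /= => /andP[xy].
  by rewrite -/(darc s y x) (negPf (darc_asym ori xy)).
have [ch st szp lt3] := att_chain Ea.
have inv2 := inv' _ _ ch st lt3.
case: i => [_|i lti] /=; last first.
  by have := IH t.+1 (rcons F e) coins _ i cat_es inv2 lti; rewrite size_rcons addSnnS.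
have [ori le3 _ _] := inv2; split=> //.
- by rewrite addn0 cat_es -(size_rcons F e) take_size_cat.
- by move=> v; rewrite odeg.
- by apply: leq_trans (flips_upd sim invs small _ _ _ _ ch st) _.
Qed.

Definition succeeds rest (log : seq (event V)) :=
  (size log == size rest) && ~~ declares_failure log.

Lemma succeeds_run K L tie t e rest w (coins : seq (K.-tuple (L.-tuple bool))) s :
  succeeds (e :: rest) (run tie t (e :: rest) (w :: coins) s) =
  let: (ok, s', _) := step (tie t) w e.1 e.2 s in
  ok && succeeds rest (run tie t.+1 rest coins s').
Proof.
rewrite /=; case: (step _ _ _ _ _) => [[ok s'] time].
by rewrite /succeeds; case: ok => //=; rewrite andbF.
Qed.

Lemma deg_lt_card F s v : {subset F <= es} -> is_orientation F s -> deg s v < #|V|.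
Proof.
move=> sub ori.
have -> : deg s v = size (outs s v) by rewrite size_map size_iota.
rewrite -(card_uniqP (outs_uniq v ori)); apply/proper_card/properP; split.
  by apply/subsetP => x _.
exists v => //; apply/negP => /(darc_adj ori) /(adj_sub sub).
by rewrite adj_irr.
Qed.

(** For [#|V| <= 3] the walks have length 0 in the algorithm, but out-degrees stay below [#|V|], so
    no walk can fail. *)
Lemma small_run K L tie t F rest (coins : seq (K.-tuple (L.-tuple bool))) s :
  0 < K -> #|V| <= 3 -> es = F ++ rest -> inv es F s -> size coins = size rest ->
  succeeds rest (run tie t rest coins s).
Proof.
move=> K0 V3; elim: rest t F coins s => [|e rest IH] t F [|w coins] s // def_es invs.
case=> sz_coins; rewrite succeeds_run.
have [v1 [v2 [r1 [r2 [n1 [n2 [[_ _ inv'] step']]]]]]] :=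
  step_spec (tie t) sim acy def_es invs.
have [time E _] := step' K L w; rewrite E /step_result.
have deg2 v : deg s v < 3.
  have [ori _ _ _] := invs; apply: leq_trans V3; apply: deg_lt_card ori.
  by move=> x xF; rewrite def_es mem_cat xF.
have wkS bits u path : wk s bits u path.
  by elim: bits u path => [|b bits IHb] u path /=; case: ifP; rewrite ?deg2.
have attS (w' : seq (L.-tuple bool)) : 0 < size w' -> att s w' v1.
  by case: w' => //= b w' _; have := wkS b v1 [::]; case: (wk _ _ _ _).
case Ea: (att s w v1) => [[u path]|].
  have [ch st _ lt3] := att_chain Ea.
  by apply: IH (inv' _ _ ch st lt3) sz_coins; rewrite cat_rcons.
by have := attS w; rewrite Ea size_tuple K0 => /(_ isT).
Qed.

End Run.

(** * Counting random bits *)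

Section TupleSums.
Variables (R : Type) (idx : R) (op : Monoid.com_law idx) (T : finType).

Lemma big_tuple0 (f : 0.-tuple T -> R) : \big[op/idx]_w f w = f [tuple].
Proof.
rewrite (bigD1 [tuple]) //= big_pred0 ?Monoid.mulm1 // => w.
by apply/negbF/eqP; exact: tuple0.
Qed.

Lemma big_tupleS n (f : n.+1.-tuple T -> R) :
  \big[op/idx]_w f w = \big[op/idx]_(c : T) \big[op/idx]_(w : n.-tuple T) f [tuple of c :: w].
Proof.
rewrite pair_big /=.
rewrite (reindex (fun p : T * n.-tuple T => [tuple of p.1 :: p.2])) //=.
exists (fun w : n.+1.-tuple T => (thead w, [tuple of behead w])) => [[c w] _|w _] /=.
  by rewrite theadE; congr (_, _); apply: val_inj.
by rewrite -tuple_eta.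
Qed.

End TupleSums.

Section Counting.
Variable V : finType.
Implicit Types (s : state V) (A : seq V).

Fixpoint endpoint s (bits : seq bool) (v : V) : option V :=
  if deg s v < 2 then None else
  if bits is b :: bits' then endpoint s bits' (out s v b) else Some v.

(** One entry for each bit string whose walk makes all [j] moves and stops at out-degree at least 2;
    strings that end early have none. *)
Fixpoint ends s (j : nat) (v : V) : seq V :=
  if deg s v < 2 then [::] else
  if j is j'.+1 then ends s j' (out s v 0) ++ ends s j' (out s v 1) else [:: v].

Lemma sum_endpoint s L v (f : V -> nat) :
  \sum_(bits : L.-tuple bool) oapp f 0 (endpoint s bits v) =
  \sum_(x <- ends s L v) f x.
Proof.
elim: L v => [|L IH] v.
  by rewrite big_tuple0 /=; case: ifP; rewrite ?big_nil ?big_seq1.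
rewrite big_tupleS big_bool /=; case: ifP => _.
  by rewrite big_nil !(@big1 nat 0 addn).
by rewrite big_cat /= -!IH addnC.
Qed.

(** A success at out-degree 2 comes only after all moves, so [endpoint] shows every volunteer and
    every failure. *)
Lemma wk_endpoint s bits u path :
  if wk s bits u path is Some (x, _) then
    deg s x < 3 /\ endpoint s bits u = if 1 < deg s x then Some x else None
  else exists2 x, endpoint s bits u = Some x & 2 < deg s x.
Proof.
elim: bits u path => [|b bits IH] u path /=.
  case: (ltnP (deg s u) 2) => [lt|ge]; first by rewrite ltnW // ltnNge -ltnS lt.
  by case: ltnP => ge'; [rewrite ge | exists u].
by case: (ltnP (deg s u) 2) => [lt|ge]; [rewrite ltnW // ltnNge -ltnS lt | exact: IH].
Qed.

Definition vol s A (r : option (V * seq (V * bool))) : bool :=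
  if r is Some (u, _) then (1 < deg s u) && (u \in A) else false.

Lemma sum_failed_walks s L v :
  \sum_(bits : L.-tuple bool) ~~ wk s bits v [::] =
  count (fun x => 2 < deg s x) (ends s L v).
Proof.
rewrite -sum1_count [RHS]big_mkcond -sum_endpoint; apply: eq_bigr => bits _.
have := wk_endpoint s bits v [::].
case: (wk _ _ _ _) => [[x p] [lt3 ->] /=|[x -> /= ->] //].
by case: ifP => //= _; rewrite ltnNge -ltnS lt3.
Qed.

Lemma sum_vol_walks s L v A :
  \sum_(bits : L.-tuple bool) vol s A (wk s bits v [::]) <=
  count (mem A) (ends s L v).
Proof.
rewrite -sum1_count [leqRHS]big_mkcond -sum_endpoint; apply: leq_sum => bits _.
have := wk_endpoint s bits v [::].
case: (wk _ _ _ _) => [[x p] [lt3 ->] /=|//].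
by case: ifP => //= _; case: (x \in A).
Qed.

Lemma card_bits L : #|{: L.-tuple bool}| = 2 ^ L.
Proof. by rewrite card_tuple card_bool. Qed.

(** The walks use disjoint bits, so the numbers of failing strings multiply. *)
Lemma sum_failed_atts s L K v :
  \sum_(w : K.-tuple (L.-tuple bool)) ~~ att s w v =
  (count (fun x => 2 < deg s x) (ends s L v)) ^ K.
Proof.
elim: K => [|K IH]; first by rewrite big_tuple0.
rewrite big_tupleS expnS -sum_failed_walks big_distrl /=; apply: eq_bigr => bits _.
case: (wk _ _ _ _) => [r|] /=; first by rewrite big1.
by rewrite mul1n sum_failed_walks -IH.
Qed.

(* The success probability of each attempt is at least one half, hence the
   factor 2. *)
Lemma sum_vol_atts s L K v A :
  2 * count (fun x => 2 < deg s x) (ends s L v) <= 2 ^ L ->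
  (\sum_(w : K.-tuple (L.-tuple bool)) vol s A (att s w v)) * 2 ^ L <=
  2 * count (mem A) (ends s L v) * (2 ^ L) ^ K.
Proof.
set f := count _ _; set M := 2 ^ L => fM.
elim: K => [|K IH]; first by rewrite big_tuple0.
rewrite big_tupleS /=; set H := \sum_w _ in IH.
(* The first walk either succeeds and leaves the other bits free, or fails, for [f] of the strings,
   and hands over to the rest. *)
have -> : \sum_(bits : L.-tuple bool) \sum_(w : K.-tuple (L.-tuple bool))
     vol s A (if wk s bits v [::] is Some r then Some r else att s w v) =
   \sum_(bits : L.-tuple bool) vol s A (wk s bits v [::]) * M ^ K + f * H.
  rewrite /f -sum_failed_walks big_distrl /= -big_split; apply: eq_bigr => bits _.
  case: (wk _ _ _ _) => [r|] /=; last by rewrite mul0n mul1n.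
  by rewrite sum_nat_const card_tuple card_bits mulnC mul0n addn0.
rewrite -big_distrl /=; have := sum_vol_walks s L v A.
move: (\sum_bits _) (count _ _) IH => p a IH pa; rewrite expnS.
move: (M ^ K) IH => MK IH.
(* Each of the two terms is at most half of the right-hand side, the second one because
   [2 * f <= M]. *)
have h1 : p * MK * M <= a * MK * M by rewrite !leq_mul.
have h2 : f * (H * M) <= f * (2 * a * MK) by rewrite leq_mul2l IH orbT.
have h3 : 2 * f * (a * MK) <= M * (a * MK) by rewrite leq_mul2r fM orbT.
nia.
Qed.

End Counting.

(** * The deterministic family of lists of ends *)

Section Ends.
Variables (V : finType) (es : seq (V * V)).
Hypotheses (sim : simple_edges es) (acy : acyclic es).
Implicit Types (F rest : seq (V * V)) (s : state V) (A : seq V).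

Lemma ends_path s j v x : x \in ends s j v ->
  exists2 p, path (darc s) v p & last v p = x.
Proof.
elim: j v => [|j IH] v /=; case: ltnP => // ge2.
  by rewrite inE => /eqP->; exists [::].
have arc b : b < 2 -> darc s v (out s v b).
  by move=> b2; apply/outsP; exists b => //; apply: leq_trans ge2.
rewrite mem_cat => /orP[] /IH[p pP <-].
  by exists (out s v 0 :: p); rewrite //= arc.
by exists (out s v 1 :: p); rewrite //= arc.
Qed.

Lemma ends_small F s j v1 v2 x : is_orientation F s ->
  #|tree F v1| <= #|tree F v2| -> x \in ends s j v1 -> in_small F v1 v2 x.
Proof.
move=> ori small /ends_path[p pP <-]; rewrite /in_small small andbT conn_sym.
by apply/connectP; exists p => //; apply: sub_path pP => y z /(darc_adj ori).
Qed.

(** An end [x] reached through both primary edges of [v] would put both heads in [toward es v x];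
    they would coincide, although the out-going edges of [v] have distinct heads. *)
Lemma ends_uniq F s j v : {subset F <= es} -> is_orientation F s ->
  uniq (ends s j v).
Proof.
move=> sub ori; elim: j v => [|j IH] v /=; case: ltnP => // ge2.
have arc b : b < 2 -> darc s v (out s v b).
  by move=> b2; apply/outsP; exists b => //; apply: leq_trans ge2.
have sub_arc : subrel (darc s) (adj es) by move=> x y /(darc_adj ori); apply: adj_sub.
rewrite cat_uniq !IH andbT /=; apply/hasPn => x x1; apply/negP => /= x0.
have tow b : b < 2 -> x \in ends s j (out s v b) -> out s v b \in toward es v x.
  move=> b2 /ends_path[p pP <-]; rewrite inE sub_arc ?arc //=.
  have: uniq [:: v, out s v b & p].
    apply: (uniq_dipath sim acy sub_arc) => [y z /(darc_asym ori) //|/=].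
    by rewrite pP arc.
  move=> /andP[vN _]; apply/connectP; exists p => //.
  move: (out s v b) vN pP; elim: p => [|z p IHp] w //=.
  rewrite !inE !negb_or => /and3P[vw vz vp] /andP[wz zp].
  by rewrite /avoid sub_arc //= eq_sym vw eq_sym vz IHp // inE negb_or vz.
have E := towardP acy sim (tow _ (isT : 0 < 2) x0) (tow _ (isT : 1 < 2) x1).
have := outs_uniq v ori; rewrite /outs -(subnKC ge2) /= E inE eqxx.
by [].
Qed.

(* A deterministic family containing every list [ends s j v]; the empty list
   stands for walks that all end early. *)
Fixpoint virt (j : nat) (v : V) : seq (seq V) :=
  if j is j'.+1 then
    let S := flatten [seq virt j' w | w <- enum (heads es v)] in
    [::] :: [seq A ++ B | A <- S, B <- S]
  else [:: [::]; [:: v]].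

Lemma ends_virt F s j v : inv es F s -> ends s j v \in virt j v.
Proof.
case=> _ _ _ hd; elim: j v => [|j IH] v /=.
  by case: ifP; rewrite !inE eqxx ?orbT.
case: ltnP => [_|ge2]; first by rewrite inE eqxx.
have inS b : b < 2 ->
    ends s j (out s v b) \in flatten [seq virt j w | w <- enum (heads es v)].
  move=> b2; apply/flatten_mapP; exists (out s v b) => //.
  by rewrite mem_enum hd // (leq_trans b2).
by rewrite inE; apply/orP; right; apply: allpairs_f; apply: inS.
Qed.

Lemma size_ends j v A : A \in virt j v -> size A <= 2 ^ j.
Proof.
elim: j v A => [|j IH] v A; first by rewrite !inE => /orP[] /eqP->.
rewrite inE => /orP[/eqP-> //|/allpairsP[[B C] [/= /flatten_mapP[w _ hB]]]].
case/flatten_mapP=> w' _ hC ->; rewrite size_cat expnS mul2n -addnn.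
by rewrite leq_add // (IH _ _ hB, IH _ _ hC).
Qed.

(** With [D = lg #|V|], the sizes satisfy [N' <= 1 + (D * N) ^ 2]. The factor [X] closes the
    induction: if [X * N <= Y] and [X <= Y], then [X ^ 2 * N' <= (1 + D ^ 2) * Y ^ 2 <= X * Y ^
    2]. *)
Lemma size_virt j v (X := (lg #|V|).+1 ^ 2) :
  X * size (virt j v) <= (2 * X) ^ (2 ^ j).
Proof.
have X0 : 0 < X by rewrite expn_gt0.
elim: j v => [|j IH] v; first by rewrite /= expn1 mulnC.
set Y := (2 * X) ^ (2 ^ j) in IH.
have XY : X <= Y.
  rewrite /Y -[X in X <= _]expn1 (leq_trans (_ : _ <= (2 * X) ^ 1)) //.
    by rewrite !expn1 leq_pmull.
  by rewrite leq_pexp2l ?muln_gt0 ?X0 // expn_gt0.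
have -> : (2 * X) ^ (2 ^ j.+1) = Y ^ 2 by rewrite -expnM expnSr.
rewrite /=; set S := flatten [seq virt j w | w <- enum (heads es v)];
  have hS : X * size S <= lg #|V| * Y.
  apply: leq_trans (_ : #|heads es v| * Y <= _); last first.
    by rewrite leq_mul2r card_heads ?orbT.
  rewrite size_flatten /shape -map_comp sumnE big_map big_distrr /=.
  rewrite cardE -(sum1_size (enum (heads es v))) big_distrl /=. apply: leq_sum => w _.
  by rewrite mul1n.
rewrite size_allpairs; move: (size S) hS => z hS.
suff: X * (X * (1 + z * z)) <= X * (Y ^ 2) by rewrite leq_pmul2l // mulnC.
have h : (X * z) * (X * z) <= (lg #|V| * Y) * (lg #|V| * Y) by rewrite leq_mul.
have h2 : X * X <= Y * Y by rewrite leq_mul.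
have eX : X = lg #|V| * lg #|V| + 2 * lg #|V| + 1 by rewrite /X -mulnn; lia.
have -> : X * Y ^ 2 = (lg #|V| * lg #|V| + 2 * lg #|V| + 1) * (Y * Y).
  by rewrite -eX -mulnn.
have -> : X * (X * (1 + z * z)) = X * X + X * z * (X * z) by rewrite mulnDr
  muln1 mulnDr mulnA mulnACA.
move: (lg _) h => l h.
apply: leq_trans (leq_add h2 h) _.
by rewrite !mulnDl; nia.
Qed.

(** By [ends_uniq] no list of ends is lost by the filter, and in a duplicate-free list a volunteer
    counts only once. *)
Definition fam L : seq (seq V) :=
  [seq A <- flatten [seq virt L v | v <- enum V] | uniq A].

Lemma ends_fam F rest s L v : es = F ++ rest -> inv es F s -> ends s L v \in fam L.
Proof.
move=> def_es invs; have [ori _ _ _] := invs.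
rewrite mem_filter (ends_uniq _ _ _ ori) /=; last by move=> x xF; rewrite def_es mem_cat xF.
by apply/flatten_mapP; exists v; rewrite ?mem_enum //; exact: ends_virt invs.
Qed.

Lemma fam_uniq L A : A \in fam L -> uniq A.
Proof. by rewrite mem_filter => /andP[]. Qed.

Lemma fam_size L A : A \in fam L -> size A <= 2 ^ L.
Proof. by rewrite mem_filter => /andP[_ /flatten_mapP[v _ /size_ends]]. Qed.

Lemma size_fam L : size (fam L) <= #|V| * (2 * (lg #|V|).+1 ^ 2) ^ (2 ^ L).
Proof.
rewrite size_filter; apply: leq_trans (count_size _ _) _.
rewrite size_flatten /shape -map_comp sumnE big_map [X in _ <= X * _]cardE
  -[size (enum V)]sum1_size.
rewrite big_distrl /=; apply: leq_sum => v _; rewrite mul1n.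
by apply: (leq_trans _ (size_virt L v)); rewrite leq_pmull // expn_gt0.
Qed.

End Ends.

(** * The exponential potential *)

Section Potential.
Variables (V : finType) (es : seq (V * V)) (K L m0 lam : nat).
Hypotheses (sim : simple_edges es) (acy : acyclic es).
Hypotheses (m0L : 2 * m0 = 2 ^ L) (lam_gt0 : 0 < lam).
Implicit Types (F rest : seq (V * V)) (s : state V) (A : seq V).

Definition full s A := count (fun x => 2 < deg s x) A.

Lemma full_step s v1 v2 r1 r2 n1 n2 (w : seq (L.-tuple bool)) A : uniq A ->
  full (step_result v1 v2 r1 r2 n1 n2 w s).2 A <= full s A + vol s A (att s w v1).
Proof.
move=> uA; rewrite /step_result; case: (att s w v1) => [[u path]|] /=; last by rewrite addn0.
rewrite /full; set P := fun x => 2 < deg s x.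
apply: leq_trans (_ : count (predU P (fun x => (x == u) && (1 < deg s u))) A <= _).
  apply: sub_count => x; rewrite /P deg_upd /=; case: (eqVneq x u) => [->|_] /=.
    by rewrite addn1 ltnS => ->; rewrite orbT.
  by rewrite addn0 orbF.
apply: leq_trans (_ : count P A + count (fun x => (x == u) && (1 < deg s u)) A <= _).
  by rewrite -count_predUI leq_addr.
rewrite leq_add2l.
case: (1 < deg s u) => /=;
  last by rewrite (eq_count (a2 := pred0)) ?count_pred0 // => x; rewrite andbF.
by rewrite (eq_count (a2 := pred1 u)) ?count_uniq_mem // => x; rewrite andbT.
Qed.

Section OneStep.
Variables (F rest : seq (V * V)) (e : V * V) (s : state V).
Variables (v1 v2 r1 r2 : V) (n1 n2 : nat).
Hypotheses (def_es : es = F ++ e :: rest) (invs : inv es F s).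
Hypothesis dat : step_data es F e s v1 v2 r1 r2 n1 n2.
Hypothesis good : full s (ends s L v1) < m0.

Let res (w : K.-tuple (L.-tuple bool)) := step_result v1 v2 r1 r2 n1 n2 w s.

(** The ends are distinct vertices of the smaller tree, so those in [A] are among the vertices that
    this step moves. *)
Lemma count_ends A : uniq A ->
  count (mem A) (ends s L v1) <= count (moved_at es (size F)) A.
Proof.
move=> uA; have [ori _ _ _] := invs; have [e_v small _] := dat.
rewrite -!size_filter; apply: uniq_leq_size.
  by rewrite filter_uniq // (ends_uniq sim acy _ _ _ ori) // => x xF;
    rewrite def_es mem_cat xF.
move=> x; rewrite !mem_filter => /andP[/= -> /(ends_small ori small) h].
by rewrite (small_moved def_es e_v h).
Qed.

(** The weight grows at most by the factor [lam], and only if a vertex of [A] volunteers, which has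
    probability at most [2 * a / 2 ^ L]. *)
Lemma weight_step A : uniq A ->
  (\sum_w lam ^ full (res w).2 A) * 2 ^ L <=
  (2 ^ L) ^ K * lam ^ full s A * (2 ^ L + 2 * lam * count (moved_at es (size F)) A).
Proof.
move=> uA; set a := count _ A.
have le1 w : lam ^ full (res w).2 A <=
    lam ^ full s A + lam ^ full s A * lam * vol s A (att s w v1).
  apply: leq_trans (leq_pexp2l lam_gt0 (full_step _ _ _ _ _ _ _ _ uA)) _.
  by case: (vol _ _ _); rewrite ?addn0 ?addn1 ?muln0 ?addn0 // muln1 expnSr leq_addl.
apply: leq_trans (_ : (\sum_(w : K.-tuple (L.-tuple bool)) (lam ^ full s A +
  lam ^ full s A * lam *
    vol s A (att s w v1))) * 2 ^ L <= _); first by rewrite leq_mul2r leq_sum ?orbT.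
rewrite big_split /= sum_nat_const card_tuple card_bits -big_distrr /=.
have hf : 2 * count (fun x => 2 < deg s x) (ends s L v1) <= 2 ^ L.
  by rewrite -m0L leq_mul2l /= ltnW.
have := sum_vol_atts K A hf; have := count_ends uA; rewrite -/a.
move: (\sum_w _) (count _ _) (lam ^ _) (2 ^ L) => H p X M; move: (M ^ K) => N pa le2.
have le3 : X * lam * (H * M) <= X * lam * (2 * a * N).
  by apply: leq_mul => //; apply: leq_trans le2 _; rewrite !leq_mul.
nia.
Qed.

(** Fewer than half of the strings fail, independently in each of the [K] walks. *)
Lemma fail_step : (\sum_w ~~ (res w).1) * 2 ^ K <= (2 ^ L) ^ K.
Proof.
have -> : \sum_w ~~ (res w).1 = full s (ends s L v1) ^ K.
  rewrite /full -sum_failed_atts; apply: eq_bigr => w _.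
  by rewrite /res /step_result; case: (att s w v1) => [[u path]|].
rewrite -expnMn -m0L; case: (K) => // k.
by rewrite leq_exp2r // mulnC leq_mul2l ltnW.
Qed.

End OneStep.

Local Open Scope ring_scope.

Definition rho : rat := 1 + (2 * lam)%:R / (2 ^ L)%:R.

Definition remaining F A : nat :=
  (\sum_(size F <= r < size es) count (moved_at es r) A)%N.

(* The weight of [A] grows with its number of vertices of out-degree 3; the
   power of [rho] pays in advance for the growth expected in later steps. *)
Definition Phi F s : rat :=
  \sum_(A <- fam es L) (lam ^ full s A)%:R * rho ^+ remaining F A.

Lemma rho_ge1 : 1 <= rho.
Proof. by rewrite lerDl divr_ge0. Qed.

Lemma bernoulli (x : rat) n : 0 <= x -> 1 + n%:R * x <= (1 + x) ^+ n.
Proof.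
move=> x0; elim: n => [|n IH]; first by rewrite mul0r addr0 expr0.
rewrite exprS; apply: le_trans (ler_wpM2l _ IH); last by rewrite addr_ge0.
have : 0 <= n%:R * (x * x) by rewrite !mulr_ge0.
by rewrite -natr1; nra.
Qed.

Lemma remaining_rcons F e rest A : es = F ++ e :: rest ->
  remaining F A = (count (moved_at es (size F)) A + remaining (rcons F e) A)%N.
Proof.
move=> def_es; rewrite /remaining size_rcons big_ltn //.
by rewrite def_es size_cat /= -addn1 leq_add2l.
Qed.

Lemma Phi_ge0 F s : 0 <= Phi F s.
Proof.
by apply: sumr_ge0 => A _; rewrite mulr_ge0 // exprn_ge0 // (le_trans ler01 rho_ge1).
Qed.

(** The bad list of ends belongs to the family, and its own term is already at least [lam ^ m0]. *)
Lemma Phi_bad F rest s v : es = F ++ rest -> inv es F s ->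
  (m0 <= full s (ends s L v))%N -> 1 <= Phi F s / (lam ^ m0)%:R.
Proof.
move=> def_es invs bad.
have l0 : 0 < (lam ^ m0)%:R :> rat by rewrite ltr0n expn_gt0 lam_gt0.
rewrite ler_pdivlMr // mul1r.
have inA := ends_fam sim acy L v def_es invs.
rewrite /Phi (perm_big _ (perm_to_rem inA)) big_cons /=.
apply: ler_wpDr; first by apply: sumr_ge0 => A _;
  rewrite mulr_ge0 // exprn_ge0 // (le_trans ler01 rho_ge1).
apply: le_trans (_ : (lam ^ full s (ends s L v))%:R <= _).
  by rewrite ler_nat leq_pexp2l.
by rewrite ler_peMr // exprn_ege1 // rho_ge1.
Qed.

(** If the step moves [a] vertices of [A], the mean weight grows by at most
    [1 + a * (rho - 1) <= rho ^ a], while [remaining] drops by exactly [a]. *)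
Lemma Phi_step F rest e s v1 v2 r1 r2 n1 n2 : es = F ++ e :: rest -> inv es F s ->
  step_data es F e s v1 v2 r1 r2 n1 n2 -> (full s (ends s L v1) < m0)%N ->
  \sum_(w : K.-tuple (L.-tuple bool))
     Phi (rcons F e) (step_result v1 v2 r1 r2 n1 n2 w s).2
  <= (#|{: K.-tuple (L.-tuple bool)}|)%:R * Phi F s.
Proof.
move=> def_es invs dat good; rewrite /Phi exchange_big big_distrr /=.
rewrite big_seq [leRHS]big_seq; apply: ler_sum => A /fam_uniq uA.
rewrite -big_distrl /= (remaining_rcons _ def_es) exprD !mulrA.
rewrite ler_wpM2r ?exprn_ge0 ?(le_trans ler01 rho_ge1) // -natr_sum.
have M0 : 0 < (2 ^ L)%:R :> rat by rewrite ltr0n expn_gt0.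
have := weight_step def_es invs dat good uA.
set a := count _ A; rewrite card_tuple card_bits => le1.
apply: le_trans (_ : ((2 ^ L) ^ K)%:R * (lam ^ full s A)%:R *
   (1 + a%:R * ((2 * lam)%:R / (2 ^ L)%:R)) <= _); last first.
  by rewrite ler_wpM2l ?mulr_ge0 // bernoulli // divr_ge0.
rewrite -(ler_pM2r M0); move: le1; rewrite -(ler_nat rat) natrM => /le_trans; apply.
rewrite le_eqVlt; apply/orP; left; apply/eqP; rewrite !natrM natrD !natrM.
move: ((2 ^ L) ^ K)%:R (lam ^ _)%:R ((2 ^ L)%:R : rat) M0 => N X M M0.
by field; rewrite gt_eqF.
Qed.

(** Induction on the arrivals left. At a bad step the bound is at least 1 by [Phi_bad]; at a good
    one, immediate failure costs [2 ^ -K] and [Phi_step] covers the continuations. *)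
Lemma failure_bound rest tie t F s : es = F ++ rest -> inv es F s ->
  (\sum_(w : (size rest).-tuple (K.-tuple (L.-tuple bool)))
     ~~ succeeds rest (run tie t rest w s))%:R <=
  (#|{: K.-tuple (L.-tuple bool)}| ^ size rest)%:R *
    (Phi F s / (lam ^ m0)%:R + (size rest)%:R / (2 ^ K)%:R) :> rat.
Proof.
set C := #|_|; elim: rest t F s => [|e rest IH] t F s def_es invs.
  by rewrite big_tuple0 /= mul0r addr0 expn0 mul1r divr_ge0 // Phi_ge0.
have [v1 [v2 [r1 [r2 [n1 [n2 [dat step']]]]]]] :=
  step_spec (tie t) sim acy def_es invs.
have [bad|good] := leqP m0 (full s (ends s L v1)).
  apply: le_trans (_ : (C ^ size (e :: rest))%:R * 1 <= _); last first.
    rewrite ler_wpM2l // ler_wpDr ?divr_ge0 //.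
    exact: Phi_bad def_es invs bad.
  rewrite mulr1 ler_nat -card_tuple -sum1_card; apply: leq_sum => w _.
  exact: leq_b1.
pose res (w : K.-tuple (L.-tuple bool)) := step_result v1 v2 r1 r2 n1 n2 w s.
rewrite big_tupleS natr_sum.
set N := (C ^ size rest)%N in IH.
have inv_res (w : K.-tuple (L.-tuple bool)) : (res w).1 -> inv es (rcons F e) (res w).2.
  rewrite /res /step_result; case Ea: (att s w v1) => [[u path]|] // _.
  by have [ch st _ lt3] := att_chain Ea; apply: (step_inv dat).
apply: le_trans (_ : \sum_(w : K.-tuple (L.-tuple bool)) N%:R * ((~~ (res w).1)%:R +
    Phi (rcons F e) (res w).2 / (lam ^ m0)%:R + (size rest)%:R / (2 ^ K)%:R) <= _).
  apply: ler_sum => w _; have [time E _] := step' K L w.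
  under eq_bigr => w' _ do rewrite [tval _]/= succeeds_run E.
  rewrite -/(res w); move: (inv_res w); case: (res w) => [[] s'] /= inv'.
    rewrite add0r; apply: (IH t.+1 (rcons F e)); last exact: inv'.
    by rewrite cat_rcons.
  (* After an immediate failure all [N] continuations count as failing; the indicator pays for
     them. *)
  rewrite sum1_card card_tuple -/C -/N ler_peMr // -addrA ler_wpDr //.
  by rewrite addr_ge0 // divr_ge0 // Phi_ge0.
rewrite -big_distrr /= expnS mulnC natrM -mulrA ler_wpM2l //.
rewrite !big_split /= -big_distrl /= sumr_const -/C.
have fails : \sum_w (~~ (res w).1)%:R <= C%:R / (2 ^ K)%:R :> rat.
  rewrite ler_pdivlMr ?ltr0n ?expn_gt0 // -natr_sum -natrM ler_nat /C card_tuple card_bits.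
  exact: fail_step.
have phis : (\sum_w Phi (rcons F e) (res w).2) / (lam ^ m0)%:R <=
    C%:R * Phi F s / (lam ^ m0)%:R.
  by rewrite ler_wpM2r ?invr_ge0 //; exact: Phi_step def_es invs dat good.
apply: le_trans (lerD (lerD fails phis) (lexx _)) _.
rewrite -mulr_natl -natr1 le_eqVlt; apply/orP; left; apply/eqP; ring.
Qed.

End Potential.

(** * Choice of the parameters *)

Section Arithmetic.
Local Open Scope nat_scope.

Lemma lg_gt n : 3 < n -> 1 < lg n.
Proof. by move=> n3; apply: trunc_log_max. Qed.

Lemma lglg_gt0 n : 3 < n -> 0 < lglg n.
Proof. by move=> n3; apply: trunc_log_max => //; apply: lg_gt. Qed.

Lemma lt_expn_lg n : 0 < n -> n < 2 ^ (lg n).+1.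
Proof. by move=> n0; have /andP[] := trunc_log_bounds (isT : 1 < 2) n0. Qed.

(* With [q = 2 ^ l] and [M = 2 ^ (c * l)], the two sides are at most
   [2 ^ (1 + 2 * a.+1 * q + 5 * l * M + 8 * lam * q)] and exactly
   [2 ^ (17 * l * M)], where [lam * q <= M] as [c > 35]. *)
Lemma parameter_bound a c n (l := lglg n) (lam := 2 ^ (34 * l)) :
  3 < n -> 2 * a + 40 <= c ->
  2 * n ^ a * (n * (2 * (lg n).+1 ^ 2) ^ (2 ^ (c * l)) * 2 ^ (4 * lam * lg n)) <=
  lam ^ (2 ^ (c * l).-1).
Proof.
move=> n3 ca; have n0 : 0 < n by lia.
have l0 : 0 < l by apply: lglg_gt0.
have l1 : 1 < lg n by apply: lg_gt.
set q := 2 ^ l; set M := 2 ^ (c * l).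
have q0 : 0 < q by rewrite expn_gt0.
have Dq : (lg n).+1 <= 2 * q.
  by rewrite /q -expnS; apply: lt_expn_lg; rewrite ltnW.
have nq : n <= 2 ^ (2 * q).
  by apply: leq_trans (ltnW (lt_expn_lg n0)) _; rewrite leq_pexp2l.
have b1 : 2 * (lg n).+1 ^ 2 <= 2 ^ (5 * l).
  apply: leq_trans (_ : 2 * (2 * q) ^ 2 <= _).
    by rewrite leq_mul2l /= leq_exp2r.
  by rewrite -expnS -expnM -expnS leq_pexp2l //; lia.
have lamq : lam * q <= M by rewrite -expnD leq_pexp2l //; nia.
have aq : 2 * (a.+1 * q) <= M.
  apply: leq_trans (_ : 2 ^ (2 * a.+1) * q <= _).
    by rewrite mulnA leq_mul2r (ltnW (ltn_expl _ _)) ?orbT.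
  by rewrite -expnD leq_pexp2l //; nia.
have -> : lam ^ (2 ^ (c * l).-1) = 2 ^ (17 * l * M).
  rewrite -expnM; congr (2 ^ _);
    rewrite /M -[in RHS](@prednK (c * l)) ?muln_gt0 ?l0 ?andbT; last lia.
  rewrite expnS; lia.
apply: leq_trans (_ : 2 ^ (1 + 2 * (a.+1 * q) + 5 * l * M + 4 * lam * lg n) <= _).
  have -> : 2 * n ^ a * (n * (2 * (lg n).+1 ^ 2) ^ M * 2 ^ (4 * lam * lg n)) =
    2 * n ^ a.+1 * (2 * (lg n).+1 ^ 2) ^ M * 2 ^ (4 * lam * lg n).
    by rewrite [n ^ a.+1]expnSr !mulnA.
  rewrite 3!expnD expn1 !leq_mul //.
    rewrite [2 * (_ * q)]mulnCA mulnC expnM leq_exp2r //.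
  by rewrite [in 2 ^ (_ * M)]expnM leq_exp2r ?expn_gt0.
rewrite leq_pexp2l //.
have : lam * lg n <= 2 * (lam * q) by rewrite mulnCA leq_mul2l (ltnW Dq) orbT.
have M0 : 0 < M by rewrite expn_gt0.
have lM : M <= l * M by rewrite leq_pmull.
(* The exponent is at most [1 + (1 + 5 + 8) * (l * M)], below [17 * (l * M)]. *)
rewrite -!mulnA; move: (a.+1 * q) (lam * lg n) (lam * q) (l * M) aq lamq lM => x y z lM; lia.
Qed.

(** As [n <= 2 ^ (2 * lg n)], the left side is at most [2 ^ (1 + 2 * a.+1 * lg n)]; this explains
    [2 * a + 3]. *)
Lemma attempts_bound a d n : 3 < n -> 2 * a + 3 <= d ->
  2 * n ^ a * n.-1 <= 2 ^ (d * lg n).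
Proof.
move=> n3 ad; have n0 : 0 < n by lia.
have l1 : 1 < lg n by apply: lg_gt.
have nq : n <= 2 ^ (2 * lg n).
  by apply: leq_trans (ltnW (lt_expn_lg n0)) _; rewrite leq_pexp2l //; lia.
apply: leq_trans (_ : 2 * n ^ a.+1 <= _).
  by rewrite expnSr mulnA leq_mul2l leq_pred orbT.
apply: leq_trans (_ : 2 * (2 ^ (2 * lg n)) ^ a.+1 <= _).
  by rewrite leq_mul2l leq_exp2r.
by rewrite -expnM -expnS leq_pexp2l //; nia.
Qed.

Lemma time_bound c d n : 3 < n ->
  step_time n (d * lg n) (c * lglg n) <=
  (d * (6 * c + 5) + 4 * c + 25) * (lg n * lglg n).
Proof.
move=> n3; rewrite /step_time; have := lg_gt n3; have := lglg_gt0 n3.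
move: (lg n) (lglg n) => x y y0 x1.
have xy : x <= x * y by rewrite leq_pmulr.
have yx : y <= x * y by rewrite leq_pmull // ltnW.
have h1 : d * x <= d * (x * y) by rewrite leq_mul2l xy orbT.
have h2 : c * y <= c * (x * y) by rewrite leq_mul2l yx orbT.
have -> : (6 * (c * y) + 5) * (d * x) = d * (6 * c) * (x * y) + 5 * (d * x) by nia.
rewrite !mulnDl !mulnDr !mulnDl; nia.
Qed.

End Arithmetic.

(** * The success probability *)

Section Bounds.
Local Open Scope ring_scope.

(** The inequality [(1 + x) ^ h * (1 - h * x) <= 1], by induction, replaces the estimate by the
    exponential function. *)
Lemma pow_le2 (x : rat) h : 0 <= x -> h%:R * x <= 2^-1 -> (1 + x) ^+ h <= 2.
Proof.
move=> x0 hx; have : (1 + x) ^+ h * (1 - h%:R * x) <= 1.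
  elim: h {hx} => [|h IH]; first by rewrite expr0 mul0r subr0 mulr1.
  apply: le_trans IH; rewrite exprSr -mulrA ler_wpM2l ?exprn_ge0 ?addr_ge0 //.
  have : 0 <= h%:R * (x * x) by rewrite !mulr_ge0.
  by rewrite -natr1; nra.
have : 0 <= (1 + x) ^+ h by rewrite exprn_ge0 ?addr_ge0.
by nra.
Qed.

Section Probability.
Variables (V : finType) (es : seq (V * V)).
Hypotheses (sim : simple_edges es) (acy : acyclic es).

(** Double counting: each vertex of [A] is moved at most [lg #|V|] times. *)
Lemma remaining_init A : (remaining es [::] A <= size A * lg #|V|)%N.
Proof.
rewrite /remaining /= big_mkord -(sum1_size A) big_distrl /=.
under eq_bigr => r _ do rewrite -sum1_count big_mkcond.
rewrite exchange_big /=; apply: leq_sum => x _; rewrite mul1n.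
apply: leq_trans (moved_count x sim acy); apply: leq_sum => r _.
by case: (moved_at es r x).
Qed.

(** Initially every [full] is 0. The number [h] is chosen so that [h * (rho - 1) = 1 / 2], hence
    [rho ^ h <= 2] and [rho ^ (2 ^ L * D) <= 2 ^ (4 * lam * D)]. *)
Lemma Phi_init L lam h : (2 ^ L = 4 * lam * h)%N -> (0 < lam)%N ->
  Phi es L lam [::] (init V) <=
  (#|V| * (2 * (lg #|V|).+1 ^ 2) ^ (2 ^ L) * 2 ^ (4 * lam * lg #|V|))%:R.
Proof.
move=> eM lam0; have M0 : (0 < 2 ^ L)%N by rewrite expn_gt0.
have h0 : (0 < h)%N by move: M0; rewrite eM; case: (h) => //; rewrite muln0.
set D := lg #|V|; have rho1 := rho_ge1 L lam.
have rhoD : rho L lam ^+ (2 ^ L * D) <= (2 ^ (4 * lam * D))%:R.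
  have -> : (2 ^ L * D = h * (4 * lam * D))%N by rewrite eM; lia.
  rewrite exprM natrX lerXn2r ?nnegrE ?exprn_ge0 ?(le_trans ler01 rho1) //.
  apply: pow_le2; first by rewrite divr_ge0.
  rewrite eM !natrM le_eqVlt; apply/orP; left; apply/eqP.
  have l0 : lam%:R != 0 :> rat by rewrite pnatr_eq0 -lt0n.
  have h0' : h%:R != 0 :> rat by rewrite pnatr_eq0 -lt0n.
  by field; rewrite l0 h0'.
apply: le_trans (_ : \sum_(A <- fam es L) (2 ^ (4 * lam * D))%:R <= _).
  rewrite /Phi big_seq [leRHS]big_seq; apply: ler_sum => A inA.
  have -> : full (init V) A = 0%N by rewrite /full /= count_pred0.
  rewrite expn0 mul1r; apply: le_trans rhoD; apply: ler_weXn2l => //.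
  apply: leq_trans (remaining_init A) _.
  by rewrite leq_mul2r (fam_size inA) orbT.
rewrite big_const_seq count_predT iter_addr_0 -mulrnA ler_nat mulnC.
by rewrite leq_mul2r size_fam ?orbT.
Qed.

Lemma Pr_succeeds K L m0 lam tie :
  (2 * m0 = 2 ^ L)%N -> (0 < lam)%N ->
  1 - (Phi es L lam [::] (init V) / (lam ^ m0)%:R + (size es)%:R / (2 ^ K)%:R) <=
  Pr (fun w : (size es).-tuple (K.-tuple (L.-tuple bool)) =>
        succeeds es (run tie 0 es w (init V))).
Proof.
move=> eM lam0; rewrite /Pr; set P := (X in #|X|).
have := @failure_bound _ _ K _ _ _ sim acy eM lam0 es tie 0 [::] (init V)
  (erefl es) (inv_init es).
set T := (size es).-tuple _; set b := _ + _.
have -> : (\sum_(w : T) ~~ P w)%N = #|[predC P]|.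
  by rewrite -sum1_card [RHS]big_mkcond; apply: eq_bigr => w _;
    rewrite -[w \in _]/(~~ P w); case: (P w).
rewrite -card_tuple -[#|{: T}|](cardC P) natrD => le1.
have T0 : 0 < (#|P| + #|[predC P]|)%:R :> rat.
  rewrite ltr0n cardC; apply/card_gt0P;
    exists [tuple of nseq (size es) [tuple of nseq K [tuple of nseq L true]]].
  by [].
rewrite natrD in T0; rewrite ler_pdivlMr //; move: le1.
by rewrite mulrBl mul1r lerBlDr lerD2l [b * _]mulrC.
Qed.

End Probability.

Lemma dancing_walk_succeeds a c d (V : finType) (es : seq (V * V)) tie :
  (2 * a + 40 <= c)%N -> (2 * a + 3 <= d)%N -> is_tree es -> size es = #|V|.-1 ->
  1 - ((#|V|%:R : rat) ^+ a)^-1 <=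
  Pr (fun w : (size es).-tuple ((d * lg #|V|).-tuple ((c * lglg #|V|).-tuple bool)) =>
    succeeds es (run tie 0 es w (init V))).
Proof.
move=> ca da [V0 sim _ acy] sz_es; set n := #|V| in V0 sz_es *.
have na0 : 0 < (n%:R : rat) ^+ a by rewrite exprn_gt0 // ltr0n.
have [n3|n3] := leqP n 3.
  rewrite /Pr; set T := tuple_of _ _; set P := (X in #|X|).
  have nil_ok (w : seq _) : es = [::] ->
      succeeds es (@run V (d * lg n) (c * lglg n) tie 0 es w (init V)) by move=> ->.
  have all_ok (w : T) : P w.
    (* With a single vertex [lg n = 0] and there is no walk at all, but no edge arrives either. *)
    case: (posnP (size es)) => [/size0nil e0|es0]; first by apply: nil_ok.
    rewrite /P; apply: (@small_run _ _ sim acy _ _ tie 0 [::]) => //;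
      [|exact: inv_init|by rewrite size_tuple].
    have : (0 < lg n)%N by apply: trunc_log_max => //; lia.
    by rewrite muln_gt0 => ->; rewrite andbT; lia.
  rewrite (eq_card (B := predT)) => [|w]; last by rewrite !inE; exact: all_ok.
  rewrite divff ?lerBlDr ?lerDl ?invr_ge0 ?ltW // pnatr_eq0 -lt0n.
  by apply/card_gt0P; exists [tuple of nseq _ [tuple of nseq _ [tuple of nseq _ true]]].
have l0 : (0 < c * lglg n)%N by rewrite muln_gt0 lglg_gt0 // andbT; lia.
(* The exponent 34 gives [lam ^ (M / 2) = 2 ^ (17 * l * M)] for [M = 2 ^ (c * l)], enough to beat
   the family, of size at most [n * 2 ^ (5 * l * M)]. *)
set l := lglg n; pose lam := (2 ^ (34 * l))%N.
have lam0 : (0 < lam)%N by rewrite expn_gt0.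
have eM : (2 * 2 ^ (c * l).-1 = 2 ^ (c * l))%N by rewrite -expnS prednK.
apply: le_trans (Pr_succeeds sim acy _ tie eM lam0).
rewrite lerD2l lerN2.
have h1 : Phi es (c * l) lam [::] (init V) / (lam ^ (2 ^ (c * l).-1))%:R <=
    (2 * n%:R ^+ a)^-1.
  rewrite ler_pdivrMr ?ltr0n ?expn_gt0 ?lam0 // mulrC ler_pdivlMr ?mulr_gt0 //.
  have eM' : (2 ^ (c * l) = 4 * lam * 2 ^ (c * l - 34 * l - 2))%N.
    rewrite /lam -[4%N]/(2 ^ 2)%N -!expnD; congr (2 ^ _)%N.
    have : (0 < l)%N by apply: lglg_gt0.
    nia.
  apply: le_trans (ler_wpM2r _ (Phi_init sim acy eM' lam0)) _.
    by rewrite mulr_ge0 // ltW.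
  rewrite -natrX -!natrM ler_nat mulnC; exact: parameter_bound.
have h2 : (size es)%:R / (2 ^ (d * lg n))%:R <= (2 * n%:R ^+ a)^-1 :> rat.
  rewrite ler_pdivrMr ?ltr0n ?expn_gt0 // mulrC ler_pdivlMr ?mulr_gt0 //.
  rewrite mulrC -natrX -!natrM ler_nat sz_es; exact: attempts_bound.
(* Bad steps and failures at good steps each take half of [n ^ -a]. *)
apply: le_trans (lerD h1 h2) _.
by rewrite invfM -mulrDl (_ : 2^-1 + 2^-1 = 1) ?mul1r //; field.
Qed.

End Bounds.

Theorem theorem1 :
  (forall a : nat, exists c0 d0 : nat, forall c d : nat, c0 <= c -> d0 <= d ->
     forall (V : finType) (es : seq (V * V)) (tie : nat -> state V -> bool),
       is_tree es -> size es = #|V|.-1 ->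
       (1 - ((#|V|%:R : rat) ^+ a)^-1
          <= Pr (fun w : tape c d #|V| =>
                  let log := dancing_walk tie es w in
                  (size log == size es) && ~~ declares_failure log))%R)
  /\
  (forall c d : nat, exists C n0 : nat,
     forall (V : finType) (es : seq (V * V)) (tie : nat -> state V -> bool)
            (w : tape c d #|V|),
       n0 <= #|V| -> is_tree es -> size es = #|V|.-1 ->
       let log := dancing_walk tie es w in
       ~~ declares_failure log ->
       forall i : nat, i < size log ->
         let ev := nth (Event false (init V) (init V) 0) log i in
         flips (ev_before ev) (ev_after ev) <= C * lglg #|V| /\
         ev_time ev <= C * (lg #|V| * lglg #|V|))
  /\
  (forall (c d : nat) (V : finType) (es : seq (V * V))
          (tie : nat -> state V -> bool) (w : tape c d #|V|),
     is_tree es -> size es = #|V|.-1 ->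
     let log := dancing_walk tie es w in
     forall i : nat, i < size log ->
       let ev := nth (Event false (init V) (init V) 0) log i in
       (ev_ok ev -> is_orientation (take i.+1 es) (ev_after ev)) /\
       (forall v : V, outdeg (ev_after ev) v <= 3)).
Proof.
split; last split.
- move=> a; exists (2 * a + 40), (2 * a + 3) => c d ca da V es tie tree sz_es.
  (* The tape has length [#|V|.-1] instead of [size es]; with [m] general the equation can be
     rewritten in the dependent type. *)
  have H m : m = size es -> (1 - ((#|V|%:R : rat) ^+ a)^-1 <= Pr (fun w :
      m.-tuple ((d * lg #|V|).-tuple ((c * lglg #|V|).-tuple bool)) =>
      succeeds es (run tie 0 es w (init V))))%R.
    by move=> ->; apply: dancing_walk_succeeds.
  exact: H (esym sz_es).
- move=> c d; exists (d * (6 * c + 5) + 4 * c + 25), 4 => V es tie w n4 tree sz_es.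
  move=> log _ i lti ev; have [_ sim _ acy] := tree.
  have [_ _ fl tm] := run_events (F := [::]) sim acy (erefl es) (inv_init es) lti.
  split; last exact: leq_trans tm (time_bound _ _ n4).
  (* The bound is [c * lglg #|V| + 1]; from [n0 = 4] on, [lglg #|V|] is positive and absorbs the
     1. *)
  apply: leq_trans fl _; have := lglg_gt0 n4; move: (lglg _) => l l0; nia.
- move=> c d V es tie w tree sz_es log i lti ev; have [_ sim _ acy] := tree.
  by have [ori le3 _ _] := run_events (F := [::]) sim acy (erefl es) (inv_init es) lti.
Qed.
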